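(* Let $P=\mathbb{R}^2$ with polar coordinates $(\rho,\theta)$, $\rho\ge 0$, $\theta\in[0,2\pi)$, and let $g_h=d\rho^2+\sinh^2\rho\,d\theta^2$ be the hyperbolic metric on $P$. Let $S^1=\mathbb{R}/(2\pi\mathbb{Z})$ act isometrically on $(P,g_h)\times S^1(1)$ by $\tau\cdot(\rho,\theta,s)=(\rho,\theta+\tau,s+\tau)$, and identify $P$ with the quotient $[P\times S^1(1)]/S^1$ by the diffeomorphism $(\rho,\theta)\mapsto[\rho,\theta,0]$. Then the quotient metric on $P$ is $$\Upsilon(g_h)=d\rho^2+\tanh^2\rho\,d\theta^2,$$ which is Hamilton's cigar soliton metric. Moreover, for $p\in\mathbb{N}$ let $\mathbb{Z}_p=\mathbb{Z}/(p\mathbb{Z})$ act on $(P,g_h)\times S^1(1)$ by $q\cdot(\rho,\theta,s)=(\rho,\theta+2\pi q/p,s+2\pi q/p)$. Then for any sequence of positive integers $p_i\to+\infty$, the sequence of quotients $[P\times S^1(1)]/\mathbb{Z}_{p_i}$, with base points the images of a fixed point of $P\times S^1(1)$, converges in the pointed Gromov-Hausdorff topology to $P$ with the cigar soliton metric, with base point the image of the same point in $[P\times S^1(1)]/S^1\cong P$.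
   Context: $S^1(r)=\mathbb{R}/(2\pi r\mathbb{Z})$ is the circle of radius $r$, with coordinate $s\in[0,2\pi)$ and metric $r^2ds^2$. Products carry the product metric $g_{\mathrm{prod}}$. The quotient metric on the quotient of a Riemannian manifold by a free isometric action of a compact Lie group is the unique metric making the projection a Riemannian submersion; the quotients are regarded as metric spaces with the induced distance. Hamilton's cigar soliton metric is the complete metric $\dfrac{dx^2+dy^2}{1+x^2+y^2}$ on $\mathbb{R}^2$; in the coordinates $\rho=\sinh^{-1}\sqrt{x^2+y^2}$ and $\theta$ (the polar angle) it is $d\rho^2+\tanh^2\rho\,d\theta^2$. $\Upsilon(g)$ denotes the metric on $P$ obtained from a rotationally symmetric metric $g$ by the quotient construction described in the claim (radius $1$). *)

(* Defs.v *)
From Stdlib Require Import Reals ZArith ClassicalEpsilon.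
From Coquelicot Require Import Coquelicot.
Open Scope R_scope.
Set Implicit Arguments.

(** * Quotient sets *)

Definition quot (T : Type) (E : T -> T -> Prop) : Type :=
  {A : T -> Prop | exists x, A = E x}.

Definition cls (T : Type) (E : T -> T -> Prop) (x : T) : quot E :=
  exist _ (E x) (ex_intro _ x eq_refl).

Definition repr (T : Type) (E : T -> T -> Prop) (q : quot E) : T :=
  proj1_sig (constructive_indefinite_description _ (proj2_sig q)).

(** * Smooth maps between finite-dimensional normed spaces *)

(* [f] is C^(k+1) when it is Frechet differentiable and all its directional
   derivatives are C^k; this is the usual notion in finite dimension, the only
   case used below. *)
Fixpoint Ck (E F : NormedModule R_AbsRing) (k : nat) (f : E -> F) : Prop :=
  match k with
  | O => forall x, continuous f x
  | S k => exists df : E -> E -> F,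
      (forall x, filterdiff f (locally x) (df x)) /\
      (forall v, Ck E F k (fun x => df x v))
  end.

Definition smooth (E F : NormedModule R_AbsRing) (f : E -> F) : Prop :=
  forall k, Ck E F k f.

(** * Riemannian manifolds *)

Definition tensor (E : NormedModule R_AbsRing) : Type := E -> E -> E -> R.

(* A manifold is presented by its set of points [pt] and a smooth covering map
   [cov] onto it from a vector space [model]; a metric on the manifold is
   recorded by its pull-back [met] under [cov].  All the manifolds needed below
   (the plane, the circle, their product and its quotients) are covered by a
   vector space.  As [cov] is a smooth covering and [model] is simply connected,
   smooth maps and smooth curves are those which lift smoothly to the models. *)
Record mfd := Mfd {
  model : NormedModule R_AbsRing;
  pt : Type;
  cov : model -> pt;
  met : tensor model
}.

(* The last clause says that [met] is invariant under the deck transformations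
   of [cov], i.e. that it is the pull-back of a tensor on [pt]. *)
Definition is_riem_metric (M : mfd) : Prop :=
  let g := met M in
  (forall x v w, g x v w = g x w v) /\
  (forall x a v1 v2 w, g x (plus (scal a v1) v2) w = a * g x v1 w + g x v2 w) /\
  (forall x v, v <> zero -> 0 < g x v v) /\
  (forall v w, smooth (model M) R_NormedModule (fun x => g x v w)) /\
  (forall D : model M -> model M,
     smooth (model M) (model M) D -> (forall x, cov M (D x) = cov M x) ->
     forall x dD, filterdiff D (locally x) dD ->
     forall v w, g (D x) (dD v) (dD w) = g x v w).

Definition prod_mfd (M N : mfd) : mfd := {|
  model := prod_NormedModule R_AbsRing (model M) (model N);
  pt := pt M * pt N;
  cov := fun x => (cov M (fst x), cov N (snd x));
  met := fun x v w => met M (fst x) (fst v) (fst w) + met N (snd x) (snd v) (snd w)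
|}.

(** ** Length and distance *)

(* [pw_path M x y L]: some piecewise C^1 curve from [x] to [y] has length [L].
   Such a curve is a finite concatenation of images of C^1 curves of the model,
   each parametrized by [0,1] (a C^1 curve on [0,1] extends to R). *)
Inductive pw_path (M : mfd) : pt M -> pt M -> R -> Prop :=
| pw_nil x : pw_path M x x 0
| pw_cons (c c' : R -> model M) y L :
    (forall t, is_derive c t (c' t)) -> (forall t, continuous c' t) ->
    pw_path M (cov M (c 1)) y L ->
    pw_path M (cov M (c 0)) y
      (RInt (fun t => sqrt (met M (c t) (c' t) (c' t))) 0 1 + L).

Definition riem_dist (M : mfd) (x y : pt M) : R :=
  real (Glb_Rbar (pw_path M x y)).

(** ** Riemannian submersions, quotient metrics, isometries *)

Definition riem_submersion (M N : mfd) (f : pt M -> pt N) : Prop :=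
  exists F : model M -> model N,
    smooth (model M) (model N) F /\
    (forall x, f (cov M x) = cov N (F x)) /\
    forall x dF, filterdiff F (locally x) dF ->
      let horizontal v := forall k, dF k = zero -> met M x v k = 0 in
      (forall w, exists v, dF v = w) /\
      (forall v1 v2, horizontal v1 -> horizontal v2 ->
         met N (F x) (dF v1) (dF v2) = met M x v1 v2).

(* [h] is the quotient metric on the quotient of [M] by the orbit relation
   [orb]; the quotient is covered by [kappa], and [h] is expressed on [E]. *)
Definition is_quotient_metric (M : mfd) (orb : pt M -> pt M -> Prop)
    (E : NormedModule R_AbsRing) (kappa : E -> quot orb) (h : tensor E) : Prop :=
  is_riem_metric (Mfd kappa h) /\
  riem_submersion M (Mfd kappa h) (cls orb).
Arguments is_quotient_metric M orb {E} kappa h.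

(* [f] is a diffeomorphism from [E] to [F] and pulls [h] back to [g]. *)
Definition riem_isometry (E F : NormedModule R_AbsRing)
    (g : tensor E) (h : tensor F) (f : E -> F) : Prop :=
  exists f' : F -> E,
    smooth E F f /\ smooth F E f' /\
    (forall x, f' (f x) = x) /\ (forall y, f (f' y) = y) /\
    forall x df, filterdiff f (locally x) df ->
      forall v w, h (f x) (df v) (df w) = g x v w.
Arguments riem_isometry {E F} g h f.

(** * Pointed Gromov-Hausdorff convergence *)

(* Burago-Burago-Ivanov, A Course in Metric Geometry, Definition 8.1.1. *)
Definition pGH_cv (X : nat -> Type) (dX : forall n, X n -> X n -> R)
    (x : forall n, X n) (Y : Type) (dY : Y -> Y -> R) (y : Y) : Prop :=
  forall r eps, 0 < r -> 0 < eps ->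
  exists n0 : nat, forall n, (n0 <= n)%nat ->
  exists f : X n -> Y,
    f (x n) = y /\
    (forall a b, dX n (x n) a < r -> dX n (x n) b < r ->
       Rabs (dY (f a) (f b) - dX n a b) < eps) /\
    (forall b, dY y b < r - eps ->
       exists a, dX n (x n) a < r /\ dY (f a) b < eps).
Arguments pGH_cv X dX x {Y} dY y.

(** * The plane with rotationally symmetric metrics, and the circle *)

Definition R2 : NormedModule R_AbsRing :=
  prod_NormedModule R_AbsRing R_NormedModule R_NormedModule.

Definition plane (g : tensor R2) : mfd := @Mfd R2 R2 (fun z => z) g.

Definition dot (v w : R2) : R := fst v * fst w + snd v * snd w.

Definition rho (z : R2) : R := sqrt (fst z ^ 2 + snd z ^ 2).

(* The smooth structure of P is that of the Cartesian coordinates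
   (rho cos theta, rho sin theta), in which [drho] and [dtheta] below are the
   differentials of the polar coordinates away from the origin. *)
Definition drho (z v : R2) : R := dot z v / rho z.
Definition dtheta (z v : R2) : R :=
  (fst z * snd v - snd z * fst v) / rho z ^ 2.

(* d rho^2 + f(rho)^2 d theta^2; at the origin, where polar coordinates are
   singular, the continuous extension when f(0) = 0 and f'(0) = 1. *)
Definition rot_metric (f : R -> R) : tensor R2 := fun z v w =>
  if Req_dec_T (rho z) 0 then dot v w
  else drho z v * drho z w + f (rho z) ^ 2 * (dtheta z v * dtheta z w).

Definition g_hyp : tensor R2 := rot_metric sinh.

(* The map (rho, theta) |-> (rho, theta + tau). *)
Definition rot (tau : R) (z : R2) : R2 :=
  (cos tau * fst z - sin tau * snd z, sin tau * fst z + cos tau * snd z).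

Definition cong2pi (s t : R) : Prop := exists k : Z, t = s + 2 * PI * IZR k.

Definition S1 : Type := quot cong2pi.
Definition angle (s : R) : S1 := cls cong2pi s.

(* The circle of radius [r], with metric r^2 ds^2. *)
Definition circle (r : R) : mfd :=
  @Mfd R_NormedModule S1 angle (fun _ v w : R => r ^ 2 * (v * w)).

(** * Hamilton's cigar *)

Definition g_cigar : tensor R2 := fun z v w =>
  dot v w / (1 + fst z ^ 2 + snd z ^ 2).

(* (x, y) |-> the point with polar coordinates rho = arcsinh (sqrt (x^2 + y^2))
   and theta = the polar angle of (x, y). *)
Definition cigar_polar (z : R2) : R2 :=
  (arcsinh (rho z) / rho z * fst z, arcsinh (rho z) / rho z * snd z).

(** * Quotients of P x S^1(1) *)

Definition PxS1 (g : tensor R2) : mfd := prod_mfd (plane g) (circle 1).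

(* Independent of the representatives chosen by [repr]. *)
Definition act (tau : S1) (m : R2 * S1) : R2 * S1 :=
  (rot (repr tau) (fst m), angle (repr (snd m) + repr tau)).

Definition orb_S1 (m m' : R2 * S1) : Prop := exists tau : S1, m' = act tau m.

(* q in Z/pZ acts as the angle 2 pi q / p. *)
Definition orb_Zp (p : nat) (m m' : R2 * S1) : Prop :=
  exists q : Z, m' = act (angle (2 * PI * IZR q / INR p)) m.

(* The identification (rho, theta) |-> [rho, theta, 0] of P with the quotient. *)
Definition ident (z : R2) : quot orb_S1 := cls orb_S1 (z, angle 0).

(* [h] is the metric Upsilon(g) on P, transported through [ident]. *)
Definition is_Upsilon (g h : tensor R2) : Prop :=
  is_quotient_metric (PxS1 g) orb_S1 ident h.

(* The group Z_p being finite and acting freely, (P x S^1)/Z_p is covered by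
   the space which covers P x S^1. *)
Definition model_PxS1 : NormedModule R_AbsRing :=
  prod_NormedModule R_AbsRing R2 R_NormedModule.

Definition cov_Zp (p : nat) (x : model_PxS1) : quot (orb_Zp p) :=
  cls (orb_Zp p) (fst x, angle (snd x)).

Definition is_Zp_quotient_metric (p : nat) (g : tensor R2)
    (h : tensor model_PxS1) : Prop :=
  is_quotient_metric (PxS1 g) (orb_Zp p) (cov_Zp p) h.

Definition Zp_quotient (p : nat) (h : tensor model_PxS1) : mfd :=
  Mfd (cov_Zp p) h.

(* Main.v *)
Require Import Defs.
From Stdlib Require Import Reals ZArith Lra Lia Psatz.
From Stdlib Require Import Classical FunctionalExtensionality PropExtensionality ProofIrrelevance.
From Coquelicot Require Import Coquelicot.
Open Scope R_scope.

(** Write [u = x^2 + y^2] for the squared radius and [z x v] for the planar cross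
    product ([cross]).  Every metric [drho^2 + f(rho)^2 dtheta^2] is, in Cartesian
    coordinates, [v.w + K(u) (z x v)(z x w)] with [f(rho)^2 = u (1 + u K(u))] ([radial]);
    for [sinh] and [tanh] the function [K] is built from the entire function
    [sinhc u = sinh(sqrt u) / sqrt u], so that the metrics are smooth at the origin.

    The invariant of an S^1-orbit is [unwind (z, s)], which rotates [z] by [- s]; in these
    terms [ident z = [m]] means that [z] is the unwound [m].  Everything about the quotient
    metric comes from one identity, [g_prod_split]: the product metric at [(z, s)] equals the
    pull-back by [unwind] of the [tanh]-metric plus [vertical (v) vertical (w) / cosh^2 rho],
    where [vertical v] is the inner product of [v] with the generator of the action and
    [cosh^2 rho = 1 + sinh^2 rho] is the squared norm of this generator.  Hence [unwind] is a
    Riemannian submersion, and no other metric on the plane makes it one since every vector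
    has a horizontal lift.

    The cigar: [(x, y) |-> arcsinh(r)/r (x, y)] is a diffeomorphism with inverse
    [z |-> sinhc(u) z], and [tanh(arcsinh r)^2 = r^2 / (1 + r^2)].  Smoothness at the origin
    uses [arcsinh(r)/r = int_0^1 (1 + t^2 r^2)^(-1/2) dt], a smooth function of [r^2].

    The group [Z_p] acts on the universal cover by the screw motions
    [(z, s) |-> (rot tau z, s + tau)] with [tau] in [(2 pi / p) Z].  A continuous lift of the
    identity of the quotient is locally one of them, because its angle has values in a discrete
    set; so the quotient metric exists and is unique.

    Convergence: let [f] be the map from the [Z_p]-quotient to the plane induced by [unwind].
    It shortens curves by the identity ([dist_project]).  Conversely a curve of the plane has a
    horizontal lift of the same length, whose angular velocity is explicit because the metric
    is rotationally symmetric; the lift ends on the orbit of the wanted point, and the end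
    point is reached along the orbit after an angle at most [2 pi / p]
    ([dist_lift]).  So [0 <= d(a, b) - d(f a, f b) <= (2 pi / p) cosh(rho(f b))], and
    [rho] is bounded on bounded sets because [ln (1 + u)] is 1-Lipschitz for the
    [tanh]-metric ([log_growth]). *)

Notation RN := R_NormedModule.

(** * Differential calculus *)

Lemma filterdiff_pair (T U V : NormedModule R_AbsRing) (f : T -> U) (g : T -> V) x lf lg :
  filterdiff f (locally x) lf -> filterdiff g (locally x) lg ->
  filterdiff (fun y => (f y, g y) : prod_NormedModule R_AbsRing U V) (locally x)
    (fun y => (lf y, lg y)).
Proof.
  intros Hf Hg.
  apply (filterdiff_comp'_2 f g (fun u v => (u, v) : prod_NormedModule R_AbsRing U V) x
          lf lg (fun u v => (u, v)) Hf Hg).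
  apply (filterdiff_ext (fun t => t)); [ now intros [a b] |].
  apply (filterdiff_ext_lin _ (fun t => t)); [ apply filterdiff_id | now intros [a b] ].
Qed.

(** Computes a given differential coordinate by coordinate, from one-variable derivatives. *)
Lemma filterdiff_directional (E F : NormedModule R_AbsRing) (f : E -> F) x df v :
  filterdiff f (locally x) df ->
  is_derive (fun t : R => f (plus x (scal t v))) 0 (df v).
Proof.
  intros H.
  assert (H0 : plus x (scal 0 v) = x).
  { rewrite (scal_zero_l v : scal 0 v = zero). apply plus_zero_r. }
  assert (Hl : filterdiff (fun t : R => plus x (scal t v)) (locally (0 : R))
                 (fun t : R => scal t v)).
  { apply (filterdiff_ext_lin _ (fun t : R => plus zero (scal t v))).
    2: intros t; apply plus_zero_l.
    apply (filterdiff_plus_fct (U := R_NormedModule) (V := E)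
             (fun _ => x) (fun t => scal t v) (fun _ => zero) (fun t => scal t v)).
    - exact (filterdiff_const (U := R_NormedModule) (F := locally (0:R)) x).
    - apply (filterdiff_scal_l (V := E)). }
  assert (Hf : filterdiff f (locally (plus x (scal 0 v))) df) by (rewrite H0; exact H).
  pose proof (filterdiff_comp' _ f 0 _ df Hl Hf) as Hc.
  unfold is_derive. eapply filterdiff_ext_lin; [ exact Hc |].
  intros y. destruct H as [H _]. simpl. apply (linear_scal _ H).
Qed.

Lemma is_derive_fst (U V : NormedModule R_AbsRing) (f : R -> prod_NormedModule R_AbsRing U V) t l :
  is_derive f t l -> is_derive (fun t => fst (f t)) t (fst l).
Proof.
  intros H.
  pose proof (filterdiff_comp' f (fun p => fst p : U) t _ (fun p => fst p : U) H
    (filterdiff_linear _ is_linear_fst)) as H1.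
  exact H1.
Qed.

Lemma is_derive_snd (U V : NormedModule R_AbsRing) (f : R -> prod_NormedModule R_AbsRing U V) t l :
  is_derive f t l -> is_derive (fun t => snd (f t)) t (snd l).
Proof.
  intros H.
  pose proof (filterdiff_comp' f (fun p => snd p : V) t _ (fun p => snd p : V) H
    (filterdiff_linear _ is_linear_snd)) as H1.
  exact H1.
Qed.

Lemma is_derive_pair (U V : NormedModule R_AbsRing) (f : R -> U) (g : R -> V) t a b :
  is_derive f t a -> is_derive g t b ->
  is_derive (fun t => (f t, g t) : prod_NormedModule R_AbsRing U V) t (a, b).
Proof.
  intros Hf Hg. pose proof (filterdiff_pair _ _ _ f g t _ _ Hf Hg) as H. exact H.
Qed.

Lemma is_derive_eq (f : R -> R) x l1 l2 :
  is_derive f x l1 -> is_derive f x l2 -> l1 = l2.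
Proof. intros H1 H2. rewrite <- (is_derive_unique _ _ _ H1). exact (is_derive_unique _ _ _ H2). Qed.

(** * Smooth functions *)
Lemma Ck_pred (E F : NormedModule R_AbsRing) k : forall f : E -> F, Ck E F (S k) f -> Ck E F k f.
Proof.
  induction k as [|k IH]; intros f [df [H1 H2]].
  - intros x. apply filterdiff_continuous. exists (df x). apply H1.
  - exists df. split; auto.
Qed.

Lemma Ck_const (E F : NormedModule R_AbsRing) k : forall a : F, Ck E F k (fun _ => a).
Proof.
  induction k as [|k IH]; intros a.
  - intros x. apply continuous_const.
  - exists (fun _ _ => zero). split; [|intros v; apply IH].
    intros x. apply filterdiff_const.
Qed.

Lemma Ck_linear (E F : NormedModule R_AbsRing) k (f : E -> F) : is_linear f -> Ck E F k f.
Proof.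
  intros H. destruct k as [|k].
  - intros x. apply linear_cont, H.
  - exists (fun _ => f). split; [|intros v; apply Ck_const].
    intros x. apply filterdiff_linear, H.
Qed.

Lemma Ck_plus (E F : NormedModule R_AbsRing) k : forall f g : E -> F,
  Ck E F k f -> Ck E F k g -> Ck E F k (fun x => plus (f x) (g x)).
Proof.
  induction k as [|k IH]; intros f g Hf Hg.
  - intros x. apply (continuous_plus f g x); auto.
  - destruct Hf as [df [Hf1 Hf2]], Hg as [dg [Hg1 Hg2]].
    exists (fun x v => plus (df x v) (dg x v)). split.
    + intros x. apply filterdiff_plus_fct; auto.
    + intros v. apply (IH (fun x => df x v) (fun x => dg x v)); auto.
Qed.

Lemma Ck_mult (E : NormedModule R_AbsRing) k : forall f g : E -> R,
  Ck E RN k f -> Ck E RN k g -> Ck E RN k (fun x => f x * g x).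
Proof.
  induction k as [|k IH]; intros f g Hf Hg.
  - intros x. apply (continuous_mult f g x); auto.
  - pose proof (Ck_pred _ _ _ _ Hf) as Hf0. pose proof (Ck_pred _ _ _ _ Hg) as Hg0.
    destruct Hf as [df [Hf1 Hf2]], Hg as [dg [Hg1 Hg2]].
    exists (fun x v => df x v * g x + f x * dg x v). split.
    + intros x. apply (filterdiff_mult_fct f g x); auto. intros; apply Rmult_comm.
    + intros v. apply (Ck_plus E RN); apply IH; auto.
Qed.

Lemma Ck_pair (T U V : NormedModule R_AbsRing) k : forall (f : T -> U) (g : T -> V),
  Ck T U k f -> Ck T V k g ->
  Ck T (prod_NormedModule R_AbsRing U V) k (fun x => (f x, g x)).
Proof.
  induction k as [|k IH]; intros f g Hf Hg.
  - intros x. apply (continuous_comp_2 f g (fun u v => (u, v) : prod_NormedModule R_AbsRing U V));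
      [apply Hf|apply Hg|].
    apply (continuous_ext (fun t => t)); [ now intros [a b] | apply continuous_id ].
  - destruct Hf as [df [Hf1 Hf2]], Hg as [dg [Hg1 Hg2]].
    exists (fun x v => (df x v, dg x v)). split.
    + intros x. apply filterdiff_pair; auto.
    + intros v. apply (IH (fun x => df x v) (fun x => dg x v)); auto.
Qed.

(** Composition with a function of one variable for which all the successive derivatives
    [phi j] are known.  They are only required on the range of [n], which allows functions of
    [x^2 + y^2] that are well behaved on the half-line of nonnegative reals only. *)
Lemma Ck_comp_tower (E : NormedModule R_AbsRing) (n : E -> R) (phi : nat -> R -> R) :
  smooth E RN n ->
  (forall j x, is_derive (phi j) (n x) (phi (S j) (n x))) ->
  forall k j, Ck E RN k (fun x => phi j (n x)).
Proof.
  intros Hn Hphi k. induction k as [|k IH]; intros j.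
  - intros x. apply (continuous_comp n (phi j) x).
    + apply (Hn 0%nat).
    + apply (ex_derive_continuous (V := R_NormedModule)). exists (phi (S j) (n x)). apply Hphi.
  - destruct (Hn (S k)) as [dn [H1 H2]].
    exists (fun x v => dn x v * phi (S j) (n x)). split.
    + intros x. apply (filterdiff_comp' n (phi j) x (dn x) _ (H1 x) (Hphi j x)).
    + intros v. apply Ck_mult; [exact (H2 v)|exact (IH (S j))].
Qed.

Lemma smooth_comp_tower (E : NormedModule R_AbsRing) (n : E -> R) (phi : nat -> R -> R) :
  smooth E RN n ->
  (forall j x, is_derive (phi j) (n x) (phi (S j) (n x))) ->
  smooth E RN (fun x => phi 0%nat (n x)).
Proof. intros Hn H k. exact (Ck_comp_tower E n phi Hn H k 0%nat). Qed.

Lemma smooth_const (E F : NormedModule R_AbsRing) (a : F) : smooth E F (fun _ => a).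
Proof. intros k; apply Ck_const. Qed.
Lemma smooth_linear (E F : NormedModule R_AbsRing) (f : E -> F) : is_linear f -> smooth E F f.
Proof. intros H k; apply Ck_linear, H. Qed.
Lemma smooth_Rplus (E : NormedModule R_AbsRing) (f g : E -> R) :
  smooth E RN f -> smooth E RN g -> smooth E RN (fun x => f x + g x).
Proof. intros Hf Hg k; apply (Ck_plus E RN k f g); auto. Qed.
Lemma smooth_Rmult (E : NormedModule R_AbsRing) (f g : E -> R) :
  smooth E RN f -> smooth E RN g -> smooth E RN (fun x => f x * g x).
Proof. intros Hf Hg k; apply Ck_mult; auto. Qed.
Lemma smooth_Ropp (E : NormedModule R_AbsRing) (f : E -> R) :
  smooth E RN f -> smooth E RN (fun x => - f x).
Proof.
  intros Hf. replace (fun x => - f x) with (fun x => (-1) * f x)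
    by (apply functional_extensionality; intros; ring).
  apply smooth_Rmult; [apply (smooth_const E RN)|exact Hf].
Qed.
Lemma smooth_Rminus (E : NormedModule R_AbsRing) (f g : E -> R) :
  smooth E RN f -> smooth E RN g -> smooth E RN (fun x => f x - g x).
Proof. intros Hf Hg. apply smooth_Rplus; [exact Hf|apply smooth_Ropp, Hg]. Qed.
Lemma smooth_pair (T U V : NormedModule R_AbsRing) (f : T -> U) (g : T -> V) :
  smooth T U f -> smooth T V g ->
  smooth T (prod_NormedModule R_AbsRing U V) (fun x => (f x, g x)).
Proof. intros Hf Hg k; apply Ck_pair; auto. Qed.

Lemma smooth_cos_sin (E : NormedModule R_AbsRing) (f : E -> R) :
  smooth E RN f ->
  smooth E RN (fun x => cos (f x)) /\ smooth E RN (fun x => sin (f x)).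
Proof.
  intros Hf.
  set (phi := fix phi (b : bool) (j : nat) : R -> R := match j with
       | O => if b then cos else sin
       | S j => fun x => if b then - phi false j x else phi true j x end).
  assert (H : forall j b x, is_derive (phi b j) x (phi b (S j) x)).
  { induction j as [|j IH]; intros b x.
    - destruct b; [apply is_derive_cos|apply is_derive_sin].
    - destruct b.
      + apply (is_derive_opp (phi false j)). apply IH.
      + apply (IH true). }
  split.
  - apply (smooth_comp_tower E f (phi true)); auto.
  - apply (smooth_comp_tower E f (phi false)); auto.
Qed.

Lemma smooth_Rinv (E : NormedModule R_AbsRing) (f : E -> R) :
  smooth E RN f -> (forall x, f x <> 0) -> smooth E RN (fun x => / f x).
Proof.
  intros Hf H0.
  replace (fun x => / f x)
    with (fun x => (-1) ^ 0 * INR (fact 0) * (/ f x) ^ 1)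
    by (apply functional_extensionality; intros; simpl; ring).
  apply (smooth_comp_tower E f (fun j y => (-1) ^ j * INR (fact j) * (/ y) ^ S j)); [exact Hf|].
  intros j x. evar_last.
  - apply is_derive_scal. apply is_derive_pow. apply is_derive_inv.
    apply is_derive_id. apply H0.
  - rewrite fact_simpl, mult_INR, S_INR. simpl. change one with 1. field. apply H0.
Qed.

Lemma smooth_PSeries (E : NormedModule R_AbsRing) (a : nat -> R) (f : E -> R) :
  CV_radius a = p_infty -> smooth E RN f -> smooth E RN (fun x => PSeries a (f x)).
Proof.
  intros Ha Hf.
  apply (smooth_comp_tower E f (fun j => PSeries (Nat.iter j PS_derive a))); [exact Hf|].
  intros j x. apply is_derive_PSeries.
  assert (H : CV_radius (Nat.iter j PS_derive a) = p_infty).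
  { induction j as [|j IH]; [exact Ha|]. simpl. rewrite CV_radius_derive. exact IH. }
  rewrite H. exact I.
Qed.

(** * The hyperbolic sine as a function of the squared radius *)

(** [coef 0] and [coef 1] are the coefficients of the power series of [cosh (sqrt u)] and [sinh (sqrt u) / sqrt u]. *)
Definition coef (c n : nat) : R := / INR (fact (2 * n + c)).

Lemma coef_radius c : CV_radius (coef c) = p_infty.
Proof.
  assert (Hp : forall n, 0 < coef c n) by (intros n; apply Rinv_0_lt_compat, INR_fact_lt_0).
  apply CV_radius_infinite_DAlembert.
  - intros n. apply Rgt_not_eq, Hp.
  - apply is_lim_seq_le_le with (u := fun _ => 0) (w := fun n => / (INR n + 1)).
    + intros n.
      assert (E : coef c (S n) / coef c n = / ((INR n + 1) * 2 + INR c) * / (INR n * 2 + INR c + 1)).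
      { unfold coef. replace (2 * S n + c)%nat with (S (S (2 * n + c))) by lia.
        rewrite !fact_simpl, !mult_INR, !S_INR, plus_INR, mult_INR. simpl (INR 2).
        pose proof (INR_fact_neq_0 (2 * n + c)). pose proof (pos_INR n). pose proof (pos_INR c).
        field. repeat split; lra. }
      rewrite E. pose proof (pos_INR n). pose proof (pos_INR c).
      assert (H1 : 0 < / ((INR n + 1) * 2 + INR c)) by (apply Rinv_0_lt_compat; lra).
      assert (H2 : 0 < / (INR n * 2 + INR c + 1)) by (apply Rinv_0_lt_compat; lra).
      assert (H3 : / ((INR n + 1) * 2 + INR c) <= / (INR n + 1)) by (apply Rinv_le_contravar; lra).
      assert (H4 : / (INR n * 2 + INR c + 1) <= / 1) by (apply Rinv_le_contravar; lra).
      rewrite Rinv_1 in H4. rewrite Rabs_pos_eq by nra. nra.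
    + apply is_lim_seq_const.
    + apply (is_lim_seq_ext (fun n => / INR (S n))); [intros n; now rewrite S_INR|].
      apply (is_lim_seq_incr_1 (fun n => / INR n)).
      replace (Finite 0) with (Rbar_inv p_infty) by reflexivity.
      apply is_lim_seq_inv; [apply is_lim_seq_INR | easy].
Qed.

Definition sinhc (u : R) : R := PSeries (coef 1) u.
Definition sinhc_slope (u : R) : R := PSeries (PS_decr_1 (coef 1)) u.

Lemma ex_pseries_coef c u : ex_pseries (coef c) u.
Proof. apply CV_radius_inside. rewrite coef_radius. exact I. Qed.

(** Split the exponential series into even and odd parts at [x] and [- x], and subtract. *)
Lemma sinh_sinhc x : sinh x = x * sinhc (x ^ 2).
Proof.
  assert (H : forall y, exp y = PSeries (coef 0) (y ^ 2) + y * sinhc (y ^ 2)).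
  { intros y.
    assert (H : is_pseries (fun n => / INR (fact n)) y (PSeries (coef 0) (y ^ 2) + y * sinhc (y ^ 2))).
    { apply is_pseries_odd_even.
      - apply (is_pseries_ext (coef 0)); [|apply PSeries_correct, ex_pseries_coef].
        intros n. unfold coef. now rewrite Nat.add_0_r.
      - apply (is_pseries_ext (coef 1)); [easy|apply PSeries_correct, ex_pseries_coef]. }
    rewrite <- (is_pseries_unique _ _ _ (is_exp_Reals y)). apply is_pseries_unique, H. }
  unfold sinh. rewrite (H x), (H (- x)).
  replace ((- x) ^ 2) with (x ^ 2) by ring. field.
Qed.

Lemma sinhc_split u : sinhc u = 1 + u * sinhc_slope u.
Proof.
  unfold sinhc, sinhc_slope. rewrite (PSeries_decr_1 (coef 1) u (ex_pseries_coef 1 u)).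
  unfold coef at 1. simpl. now rewrite Rinv_1.
Qed.

Lemma sinhc_pos u : 0 <= u -> 0 < sinhc u.
Proof.
  intros [H|<-].
  - pose proof (sqrt_lt_R0 u H) as Hs. pose proof (sinh_lt 0 (sqrt u) Hs) as H1.
    rewrite sinh_0, sinh_sinhc, pow2_sqrt in H1 by lra. nra.
  - rewrite sinhc_split. lra.
Qed.

Lemma smooth_sinhc (E : NormedModule R_AbsRing) (f : E -> R) :
  smooth E RN f -> smooth E RN (fun x => sinhc (f x)).
Proof. apply smooth_PSeries, coef_radius. Qed.

Lemma smooth_sinhc_slope (E : NormedModule R_AbsRing) (f : E -> R) :
  smooth E RN f -> smooth E RN (fun x => sinhc_slope (f x)).
Proof. apply smooth_PSeries. rewrite CV_radius_decr_1. apply coef_radius. Qed.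

(** The square of [cosh (sqrt u)]; see [cosh_sq_cosh]. *)
Definition cosh_sq (u : R) : R := 1 + u * sinhc u ^ 2.
(** The value of [(sinh^2 rho / rho^2 - 1) / rho^2], in a form without singularity at [u = rho^2 = 0]. *)
Definition K_hyp (u : R) : R := sinhc_slope u * (sinhc u + 1).
(** The same for [tanh], from [tanh^2 = sinh^2 / cosh^2]. *)
Definition K_cig (u : R) : R := (K_hyp u - sinhc u ^ 2) / cosh_sq u.

Lemma cosh_sq_ge1 u : 0 <= u -> 1 <= cosh_sq u.
Proof. intros H. unfold cosh_sq. pose proof (pow2_ge_0 (sinhc u)). nra. Qed.

Lemma K_hyp_eq u : 1 + u * K_hyp u = sinhc u ^ 2.
Proof. unfold K_hyp. rewrite sinhc_split. ring. Qed.

Lemma K_cig_eq u : 0 <= u -> 1 + u * K_cig u = sinhc u ^ 2 / cosh_sq u.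
Proof.
  intros H. pose proof (cosh_sq_ge1 u H). pose proof (K_hyp_eq u) as HK.
  unfold K_cig.
  replace (1 + u * ((K_hyp u - sinhc u ^ 2) / cosh_sq u))
    with ((cosh_sq u + (u * K_hyp u) - u * sinhc u ^ 2) / cosh_sq u) by (field; lra).
  f_equal. unfold cosh_sq. lra.
Qed.

Lemma cosh_sq_cosh x : cosh x ^ 2 = cosh_sq (x ^ 2).
Proof.
  unfold cosh_sq.
  replace (x ^ 2 * sinhc (x ^ 2) ^ 2) with (sinh x ^ 2) by (rewrite sinh_sinhc; ring).
  unfold sinh, cosh. assert (exp x * exp (- x) = 1) by (rewrite <- exp_plus, Rplus_opp_r; apply exp_0).
  nra.
Qed.

Lemma tanh_sq x : tanh x ^ 2 = x ^ 2 * (1 + x ^ 2 * K_cig (x ^ 2)).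
Proof.
  assert (Hx : 0 <= x ^ 2) by apply pow2_ge_0.
  rewrite K_cig_eq, <- cosh_sq_cosh by exact Hx. unfold tanh.
  rewrite sinh_sinhc. assert (0 < cosh x) by (unfold cosh; pose proof (exp_pos x); pose proof (exp_pos (- x)); lra).
  field. lra.
Qed.

(** * Rotationally symmetric metrics in Cartesian coordinates *)

Definition sq (z : R2) : R := fst z ^ 2 + snd z ^ 2.
Definition cross (z v : R2) : R := fst z * snd v - snd z * fst v.
Definition radial (K : R -> R) : tensor R2 := fun z v w =>
  dot v w + K (sq z) * (cross z v * cross z w).

Lemma sq_ge0 z : 0 <= sq z.
Proof. unfold sq. pose proof (pow2_ge_0 (fst z)). pose proof (pow2_ge_0 (snd z)). lra. Qed.

Lemma sq_eq0 (z : R2) : sq z = 0 -> z = (0, 0).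
Proof.
  destruct z as [a b]. unfold sq; simpl. intros H.
  pose proof (pow2_ge_0 a). pose proof (pow2_ge_0 b).
  assert (a = 0) by nra. assert (b = 0) by nra. now subst.
Qed.

Lemma sq_lagrange z v w : sq z * dot v w = dot z v * dot z w + cross z v * cross z w.
Proof. unfold sq, dot, cross. ring. Qed.

Lemma rho_sq z : rho z ^ 2 = sq z.
Proof. unfold rho. apply pow2_sqrt, sq_ge0. Qed.

(** The cross and dot products with [z] are [rho^2 dtheta] and [rho drho], and Lagrange's
    identity [sq_lagrange] expresses the Euclidean metric with them. *)
Lemma rot_metric_radial (f K : R -> R) :
  (forall x, f x ^ 2 = x ^ 2 * (1 + x ^ 2 * K (x ^ 2))) ->
  forall z v w, rot_metric f z v w = radial K z v w.
Proof.
  intros Hf z v w. unfold rot_metric, radial. destruct Req_dec_T as [H|H].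
  - assert (Hz : z = (0, 0)) by (apply sq_eq0; rewrite <- rho_sq, H; ring).
    subst z. unfold cross; simpl. ring.
  - unfold drho, dtheta. fold (cross z v) (cross z w).
    pose proof (sq_lagrange z v w) as HL. rewrite Hf. rewrite <- (rho_sq z) in *.
    apply (Rmult_eq_reg_l (rho z ^ 2)); [|now apply pow_nonzero].
    rewrite (Rmult_plus_distr_l _ (dot v w)), HL. field. exact H.
Qed.

Lemma g_hyp_radial z v w : g_hyp z v w = radial K_hyp z v w.
Proof.
  apply rot_metric_radial. intros x. rewrite K_hyp_eq, sinh_sinhc. ring.
Qed.

Lemma rot_tanh_radial z v w : rot_metric tanh z v w = radial K_cig z v w.
Proof. apply rot_metric_radial, tanh_sq. Qed.

(** * The inverse hyperbolic sine as a function of the squared radius *)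

(** The [j]-th derivative of [1 / sqrt (1 + x)] on [x > -1]. *)
Definition isqrt_tower (j : nat) (x : R) : R :=
  (fix c j := match j with O => 1 | S j => - (1 / 2 + INR j) * c j end) j
  * (/ (1 + x)) ^ j * / sqrt (1 + x).

Lemma isqrt_tower_deriv j x : -1 < x -> is_derive (isqrt_tower j) x (isqrt_tower (S j) x).
Proof.
  intros Hx. unfold isqrt_tower.
  set (c := fix c j := match j with O => 1 | S j => - (1 / 2 + INR j) * c j end).
  change (c (S j)) with (- (1 / 2 + INR j) * c j).
  assert (H0 : is_derive (fun x => 1 + x) x 1) by (auto_derive; [exact I|ring]).
  assert (Hs : sqrt (1 + x) * sqrt (1 + x) = 1 + x) by (apply sqrt_sqrt; lra).
  assert (Hs0 : 0 < sqrt (1 + x)) by (apply sqrt_lt_R0; lra).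
  evar_last.
  - apply Derive.is_derive_mult.
    + apply is_derive_scal, is_derive_pow, is_derive_inv; [exact H0|lra].
    + apply is_derive_inv; [|lra]. apply is_derive_sqrt; [exact H0|lra].
  - cbv beta. set (s := sqrt (1 + x)) in *. rewrite <- Hs.
    destruct j as [|j]; simpl pred; rewrite ?S_INR; simpl; field; lra.
Qed.

(** The [j]-th derivative of [int_0^1 (1 + t^2 u)^(-1/2) dt], which is [arcsinh (sqrt u) / sqrt u]
    for [u > 0]; see [arcsinh_arcsinhc]. *)
Definition arcsinhc_tower (j : nat) (u : R) : R :=
  RInt (fun t => t ^ (2 * j) * isqrt_tower j (t ^ 2 * u)) 0 1.
Definition arcsinhc : R -> R := arcsinhc_tower 0.

Lemma tower_arg u t : -1 < u -> 0 <= t <= 1 -> -1 < t ^ 2 * u.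
Proof. intros Hu Ht.
  assert (H0 : 0 <= t ^ 2) by apply pow2_ge_0.
  assert (H1 : t ^ 2 <= 1) by (simpl; nra).
  destruct (Rle_or_lt 0 u) as [Hu0|Hu0]; nra.
Qed.

Lemma tower_integrable j u : -1 < u ->
  ex_RInt (fun t => t ^ (2 * j) * isqrt_tower j (t ^ 2 * u)) 0 1.
Proof.
  intros Hu. apply (ex_RInt_continuous (V := R_CompleteNormedModule)).
  rewrite Rmin_left, Rmax_right by lra. intros t Ht.
  apply (ex_derive_continuous (V := R_NormedModule)).
  apply (ex_derive_mult (fun t => t ^ (2 * j))).
  - auto_derive. exact I.
  - apply (ex_derive_comp (isqrt_tower j)).
    + eexists. apply isqrt_tower_deriv, tower_arg; assumption.
    + auto_derive. exact I.
Qed.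

Lemma arcsinhc_tower_deriv j u : -1 < u ->
  is_derive (arcsinhc_tower j) u (arcsinhc_tower (S j) u).
Proof.
  intros Hu.
  assert (Hd : forall v t, -1 < t ^ 2 * v -> is_derive (fun v => t ^ (2 * j) * isqrt_tower j (t ^ 2 * v)) v
      (t ^ (2 * S j) * isqrt_tower (S j) (t ^ 2 * v))).
  { intros v t Hv. evar_last.
    - apply is_derive_scal. apply (is_derive_comp (isqrt_tower j)); [apply isqrt_tower_deriv, Hv|].
      apply is_derive_scal. apply is_derive_id.
    - change scal with Rmult. change one with 1.
      replace (2 * S j)%nat with (2 * j + 2)%nat by lia. rewrite pow_add. ring. }
  assert (Hloc : locally u (fun v => -1 < v)) by (apply (open_gt (-1)); exact Hu).
  unfold arcsinhc_tower at 2.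
  replace (RInt (fun t => t ^ (2 * S j) * isqrt_tower (S j) (t ^ 2 * u)) 0 1)
    with (RInt (fun t => Derive (fun v => t ^ (2 * j) * isqrt_tower j (t ^ 2 * v)) u) 0 1).
  2:{ apply RInt_ext. rewrite Rmin_left, Rmax_right by lra. intros t Ht.
      apply is_derive_unique, Hd, tower_arg; lra. }
  apply (is_derive_RInt_param (fun v t => t ^ (2 * j) * isqrt_tower j (t ^ 2 * v))).
  - revert Hloc. apply filter_imp. rewrite Rmin_left, Rmax_right by lra.
    intros v Hv t Ht. eexists. apply Hd, tower_arg; assumption.
  - rewrite Rmin_left, Rmax_right by lra. intros t Ht.
    assert (Hcp : continuity_2d_pt (fun v t => t ^ 2 * v) u t).
    { apply continuity_2d_pt_mult; [|apply continuity_2d_pt_id1].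
      apply (continuity_1d_2d_pt_comp (fun t => t ^ 2) (fun _ t => t)).
      - apply derivable_continuous_pt, derivable_pt_pow.
      - apply continuity_2d_pt_id2. }
    apply continuity_2d_pt_ext_loc with (f := fun v t => t ^ (2 * S j) * isqrt_tower (S j) (t ^ 2 * v)).
    + assert (Hp : 0 < t ^ 2 * u + 1) by (pose proof (tower_arg u t Hu Ht); lra).
      destruct (Hcp (mkposreal _ Hp)) as [d Hd'].
      exists d. intros v s Hv Hs. symmetry. apply is_derive_unique, Hd.
      specialize (Hd' v s Hv Hs). simpl in Hd'. apply Rabs_def2 in Hd'. lra.
    + apply continuity_2d_pt_mult.
      * apply (continuity_1d_2d_pt_comp (fun t => t ^ (2 * S j)) (fun _ t => t)).
        -- apply derivable_continuous_pt, derivable_pt_pow.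
        -- apply continuity_2d_pt_id2.
      * apply (continuity_1d_2d_pt_comp (isqrt_tower (S j)) (fun v t => t ^ 2 * v)); [|exact Hcp].
        apply continuity_pt_filterlim. apply (ex_derive_continuous (V := R_NormedModule)).
        eexists. apply isqrt_tower_deriv, tower_arg; assumption.
  - revert Hloc. apply filter_imp. intros v Hv. apply tower_integrable, Hv.
Qed.

Lemma smooth_arcsinhc (E : NormedModule R_AbsRing) (f : E -> R) :
  smooth E RN f -> (forall x, 0 <= f x) -> smooth E RN (fun x => arcsinhc (f x)).
Proof.
  intros Hf H0. apply (smooth_comp_tower E f arcsinhc_tower); [exact Hf|].
  intros j x. apply arcsinhc_tower_deriv. specialize (H0 x). lra.
Qed.

Lemma is_derive_arcsinh x : is_derive arcsinh x (/ sqrt (x ^ 2 + 1)).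
Proof. apply is_derive_Reals, derivable_pt_lim_arcsinh. Qed.

Lemma arcsinh_arcsinhc x : arcsinh x = x * arcsinhc (x ^ 2).
Proof.
  assert (H : is_RInt (fun t => x * / sqrt ((t * x) ^ 2 + 1)) 0 1 (minus (arcsinh (1 * x)) (arcsinh (0 * x)))).
  { apply (is_RInt_derive (V := R_CompleteNormedModule) (fun t => arcsinh (t * x))).
    - intros t _. evar_last.
      + apply (is_derive_comp arcsinh (fun t => t * x)); [apply is_derive_arcsinh|].
        apply (Derive.is_derive_mult (fun t => t) (fun _ => x)); [apply is_derive_id|apply is_derive_const].
      + change scal with Rmult. change one with 1. change zero with 0. ring.
    - intros t _. apply (ex_derive_continuous (V := R_NormedModule)).
      assert (0 <= (t * x) ^ 2) by apply pow2_ge_0.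
      auto_derive. split; [nra|]. split; [|exact I]. apply Rgt_not_eq, sqrt_lt_R0. nra. }
  rewrite Rmult_1_l, Rmult_0_l, arcsinh_0 in H.
  apply (is_RInt_unique (V := R_CompleteNormedModule)) in H.
  replace (minus (arcsinh x) 0) with (arcsinh x) in H
    by (unfold minus, plus, opp; simpl; ring).
  rewrite <- H. unfold arcsinhc, arcsinhc_tower.
  rewrite <- (RInt_scal (V := R_CompleteNormedModule)).
  2: apply (tower_integrable 0); pose proof (pow2_ge_0 x); lra.
  apply RInt_ext. intros t _. change scal with Rmult. unfold isqrt_tower.
  replace ((t * x) ^ 2 + 1) with (1 + t ^ 2 * x ^ 2) by ring. simpl. ring.
Qed.

(** The derivative of [x * arcsinhc (x^2) = arcsinh x], in terms of [u = x^2]. *)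
Lemma arcsinhc_ode u : 0 <= u ->
  arcsinhc u + 2 * u * arcsinhc_tower 1 u = / sqrt (1 + u).
Proof.
  intros Hu. set (x := sqrt u). assert (Hx : x ^ 2 = u) by (apply pow2_sqrt, Hu).
  rewrite <- Hx in *.
  apply (is_derive_eq arcsinh x).
  - apply (is_derive_ext (fun x => x * arcsinhc (x ^ 2))); [intros t; symmetry; apply arcsinh_arcsinhc|].
    evar_last.
    + apply (Derive.is_derive_mult (fun x => x)); [apply is_derive_id|].
      apply (is_derive_comp arcsinhc); [apply (arcsinhc_tower_deriv 0); lra|].
      apply is_derive_pow, is_derive_id.
    + change scal with Rmult. change one with 1. simpl. ring.
  - rewrite Rplus_comm. apply is_derive_arcsinh.
Qed.

(** * Orbits *)

Lemma cls_inj (T : Type) (E : T -> T -> Prop) x y :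
  (forall z, E z z) -> cls E x = cls E y -> E x y.
Proof. intros Hr H. apply (f_equal (@proj1_sig _ _)) in H. simpl in H. rewrite H. apply Hr. Qed.

Lemma cls_eq (T : Type) (E : T -> T -> Prop) x y :
  (forall a b, E a b -> E b a) -> (forall a b c, E a b -> E b c -> E a c) ->
  E x y -> cls E x = cls E y.
Proof.
  intros Hs Ht H. unfold cls. assert (HE : E x = E y).
  { apply functional_extensionality. intros z. apply propositional_extensionality. split; eauto. }
  apply eq_sig_hprop; [|exact HE]. intros A. apply proof_irrelevance.
Qed.

Lemma cls_repr (T : Type) (E : T -> T -> Prop) (q : quot E) : cls E (repr q) = q.
Proof.
  unfold repr. destruct (ClassicalEpsilon.constructive_indefinite_description _ _) as [x Hx]; simpl.
  destruct q as [A HA]; simpl in *. apply eq_sig_hprop; [|now symmetry].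
  intros B. apply proof_irrelevance.
Qed.

Lemma cong2pi_refl s : cong2pi s s.
Proof. exists 0%Z. ring. Qed.
Lemma cong2pi_sym s t : cong2pi s t -> cong2pi t s.
Proof. intros [k ->]. exists (- k)%Z. rewrite opp_IZR. ring. Qed.
Lemma cong2pi_trans s t u : cong2pi s t -> cong2pi t u -> cong2pi s u.
Proof. intros [k ->] [l ->]. exists (k + l)%Z. rewrite plus_IZR. ring. Qed.

Lemma angle_eq s t : angle s = angle t <-> cong2pi s t.
Proof.
  split; intros H.
  - apply (cls_inj _ _ _ _ cong2pi_refl H).
  - apply cls_eq; [exact cong2pi_sym|exact cong2pi_trans|exact H].
Qed.

Lemma repr_angle s : cong2pi s (repr (angle s)).
Proof. apply angle_eq. symmetry. apply cls_repr. Qed.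

Lemma cos_sin_cong s t : cong2pi s t -> cos t = cos s /\ sin t = sin s.
Proof.
  assert (Hn : forall x n, cos (x + 2 * PI * INR n) = cos x /\ sin (x + 2 * PI * INR n) = sin x).
  { intros x n. replace (2 * PI * INR n) with (2 * INR n * PI) by ring.
    split; [apply cos_period|apply sin_period]. }
  intros [k ->]. destruct (Z_le_gt_dec 0 k) as [Hk|Hk].
  - rewrite <- (Z2Nat.id k Hk), <- INR_IZR_INZ. apply Hn.
  - destruct (Hn (s + 2 * PI * IZR k) (Z.to_nat (- k))) as [H1 H2].
    rewrite INR_IZR_INZ, Z2Nat.id, opp_IZR in H1, H2 by lia.
    replace (s + 2 * PI * IZR k + 2 * PI * - IZR k) with s in H1, H2 by ring. auto.
Qed.

Lemma rot_cong s t z : cong2pi s t -> rot t z = rot s z.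
Proof. intros H. unfold rot. destruct (cos_sin_cong s t H) as [-> ->]. reflexivity. Qed.

Lemma rot_rot a b z : rot a (rot b z) = rot (a + b) z.
Proof. unfold rot; simpl. rewrite cos_plus, sin_plus. f_equal; ring. Qed.

Lemma rot_0 z : rot 0 z = z.
Proof. destruct z as [a b]. unfold rot; simpl. rewrite cos_0, sin_0. f_equal; ring. Qed.

Lemma cos2_sin2 x : cos x * cos x = 1 - sin x * sin x.
Proof. pose proof (sin2_cos2 x) as H. unfold Rsqr in H. lra. Qed.

Lemma act_angle tau z s : act (angle tau) (z, angle s) = (rot tau z, angle (s + tau)).
Proof.
  unfold act; simpl. rewrite (rot_cong _ _ z (repr_angle tau)). f_equal. apply angle_eq, cong2pi_sym.
  destruct (repr_angle tau) as [k ->], (repr_angle s) as [l ->].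
  exists (k + l)%Z. rewrite plus_IZR. ring.
Qed.

Lemma angle_surj (sg : S1) : exists s, sg = angle s.
Proof. exists (repr sg). symmetry. apply cls_repr. Qed.

(** A complete invariant of the S^1-orbits, read on the universal cover; [unwind_pt] is the
    same map on points. *)
Definition unwind (x : model_PxS1) : R2 := rot (- snd x) (fst x).

Definition unwind_pt (m : R2 * S1) : R2 := rot (- repr (snd m)) (fst m).

Lemma unwind_pt_angle z s : unwind_pt (z, angle s) = unwind (z, s).
Proof.
  unfold unwind_pt, unwind; simpl. apply rot_cong.
  destruct (repr_angle s) as [k ->]. exists (- k)%Z. rewrite opp_IZR. ring.
Qed.

Lemma orb_S1_unwind m m' : orb_S1 m m' <-> unwind_pt m = unwind_pt m'.
Proof.
  destruct m as [z sg], m' as [z' sg'].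
  destruct (angle_surj sg) as [s ->], (angle_surj sg') as [s' ->].
  rewrite !unwind_pt_angle. unfold unwind; simpl. split.
  - intros [ta H]. destruct (angle_surj ta) as [tau ->]. rewrite act_angle in H.
    pose proof (f_equal fst H) as Hz. pose proof (f_equal snd H) as Hs. cbn [fst snd] in Hz, Hs.
    apply angle_eq in Hs. rewrite Hz, rot_rot.
    apply rot_cong. destruct Hs as [k Hk]. exists (- k)%Z. rewrite opp_IZR. lra.
  - intros H. exists (angle (s' - s)). rewrite act_angle. apply (f_equal2 pair).
    + apply (f_equal (rot s')) in H. rewrite !rot_rot in H.
      replace (s' + - s') with 0 in H by ring. rewrite rot_0 in H. now rewrite <- H.
    + apply angle_eq. exists 0%Z. ring.
Qed.

Lemma cls_S1_eq m m' : cls orb_S1 m = cls orb_S1 m' <-> unwind_pt m = unwind_pt m'.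
Proof.
  split; intros H.
  - apply orb_S1_unwind. apply cls_inj; [intros z; now apply orb_S1_unwind|exact H].
  - apply cls_eq; [| |now apply orb_S1_unwind]; intros a b *; rewrite !orb_S1_unwind; congruence.
Qed.

Lemma ident_eq z m : ident z = cls orb_S1 m <-> z = unwind_pt m.
Proof.
  unfold ident. rewrite cls_S1_eq, unwind_pt_angle. unfold unwind; simpl. now rewrite Ropp_0, rot_0.
Qed.

Lemma quot_surj (T : Type) (E : T -> T -> Prop) (q : quot E) : exists x, q = cls E x.
Proof. exists (repr q). symmetry. apply cls_repr. Qed.

Lemma ident_bij (q : quot orb_S1) : exists! z : R2, ident z = q.
Proof.
  destruct (quot_surj _ _ q) as [m ->]. exists (unwind_pt m). split.
  - now apply ident_eq.
  - intros z' H. apply ident_eq in H. now symmetry.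
Qed.

(** Lift to the universal cover of the action of [tau]; for [tau] a multiple of [2 pi / p] these are
    the deck transformations of the [Z_p]-quotient ([cov_Zp_eq]). *)
Definition screw (tau : R) (x : model_PxS1) : model_PxS1 := (rot tau (fst x), snd x + tau).
Definition zp_angle (p : nat) (k : Z) : R := 2 * PI * IZR k / INR p.

Lemma model_eq (x y : model_PxS1) : fst x = fst y -> (snd x : R) = snd y -> x = y.
Proof. destruct x, y; simpl. now intros -> ->. Qed.

Lemma screw_screw a b x : screw a (screw b x) = screw (a + b) x.
Proof. apply model_eq; simpl; [apply rot_rot|ring]. Qed.
Lemma screw_0 x : screw 0 x = x.
Proof. apply model_eq; simpl; [apply rot_0|ring]. Qed.
Lemma screw_inv tau x : screw (- tau) (screw tau x) = x.
Proof. rewrite screw_screw. replace (- tau + tau) with 0 by ring. apply screw_0. Qed.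
Lemma zp_angle_plus p k l : zp_angle p k + zp_angle p l = zp_angle p (k + l).
Proof. unfold zp_angle. rewrite plus_IZR. unfold Rdiv. ring. Qed.
Lemma zp_angle_opp p k : - zp_angle p k = zp_angle p (- k).
Proof. unfold zp_angle. rewrite opp_IZR. unfold Rdiv. ring. Qed.
Lemma unwind_screw tau x : unwind (screw tau x) = unwind x.
Proof. unfold unwind, screw; simpl. rewrite rot_rot. f_equal. ring. Qed.
Lemma unwind_eq x y : unwind x = unwind y -> y = screw (snd y - snd x) x.
Proof.
  destruct x as [z s], y as [z' s']. unfold unwind, screw; simpl. intros H. apply model_eq; simpl; [|symmetry; apply Rplus_minus].
  apply (f_equal (rot s')) in H. rewrite !rot_rot in H.
  replace (s' + - s') with 0 in H by ring. rewrite rot_0 in H. now rewrite <- H.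
Qed.

Lemma orb_Zp_cov p x y : (0 < p)%nat ->
  (orb_Zp p (fst x, angle (snd x)) (fst y, angle (snd y)) <-> exists k, y = screw (zp_angle p k) x).
Proof.
  intros Hp. assert (HP : INR p <> 0) by (apply not_0_INR; lia).
  destruct x as [z s], y as [z' s']. unfold orb_Zp, screw; simpl. split.
  - intros [q H]. fold (zp_angle p q) in H. rewrite act_angle in H.
    pose proof (f_equal fst H) as Hz. pose proof (f_equal snd H) as Hs. cbn [fst snd] in Hz, Hs.
    apply angle_eq in Hs. apply cong2pi_sym in Hs. destruct Hs as [k Hk].
    exists (q + Z.of_nat p * k)%Z. unfold zp_angle in *.
    assert (HE : 2 * PI * IZR (q + Z.of_nat p * k) / INR p = 2 * PI * IZR q / INR p + 2 * PI * IZR k).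
    { rewrite plus_IZR, mult_IZR, <- INR_IZR_INZ. field. exact HP. }
    apply model_eq; simpl.
    + rewrite Hz. symmetry. apply rot_cong. exists k. exact HE.
    + rewrite HE. lra.
  - intros [k H]. injection H as Hz Hs. exists k. fold (zp_angle p k). rewrite act_angle. now subst.
Qed.

Lemma cov_Zp_eq p x y : (0 < p)%nat ->
  (cov_Zp p x = cov_Zp p y <-> exists k, y = screw (zp_angle p k) x).
Proof.
  intros Hp.
  assert (Hm : forall m : R2 * S1, exists x : model_PxS1, m = (fst x, angle (snd x))).
  { intros [z sg]. destruct (angle_surj sg) as [s ->]. now exists (z, s). }
  rewrite <- orb_Zp_cov by exact Hp. unfold cov_Zp. split; intros H.
  - apply cls_inj; [|exact H]. intros m. destruct (Hm m) as [a ->]. apply orb_Zp_cov; [exact Hp|].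
    exists 0%Z. unfold zp_angle, Rdiv. rewrite Rmult_0_r, Rmult_0_l. now rewrite screw_0.
  - apply cls_eq; [| |exact H].
    + intros m n. destruct (Hm m) as [a ->], (Hm n) as [b ->]. rewrite !orb_Zp_cov by exact Hp.
      intros [k ->]. exists (- k)%Z. now rewrite <- zp_angle_opp, screw_inv.
    + intros m n o. destruct (Hm m) as [a ->], (Hm n) as [b ->], (Hm o) as [c ->].
      rewrite !orb_Zp_cov by exact Hp.
      intros [k ->] [l ->]. exists (l + k)%Z. now rewrite screw_screw, zp_angle_plus.
Qed.

Lemma cov_Zp_surj p (q : quot (orb_Zp p)) : exists x, q = cov_Zp p x.
Proof.
  destruct (quot_surj _ _ q) as [[z sg] ->]. destruct (angle_surj sg) as [s ->].
  now exists (z, s).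
Qed.

(** * Differentials of the unwinding map and of the screw motions *)

Lemma filterdiff_unwind x dF v : filterdiff unwind (locally x) dF ->
  dF v = rot (- snd x) (fst (fst v) + snd v * snd (fst x), snd (fst v) - snd v * fst (fst x)).
Proof.
  intros H. pose proof (filterdiff_directional _ _ _ _ _ v H) as Hd.
  destruct x as [[x1 x2] s], v as [[v1 v2] sg].
  pose proof (is_derive_fst _ _ _ _ _ Hd) as H1. pose proof (is_derive_snd _ _ _ _ _ Hd) as H2.
  rewrite (surjective_pairing (dF _)). unfold rot. simpl. f_equal.
  - apply (is_derive_eq _ _ _ _ H1).
    apply (is_derive_ext (fun t => cos (- (s + t * sg)) * (x1 + t * v1) - sin (- (s + t * sg)) * (x2 + t * v2))).
    { intros t. reflexivity. }
    auto_derive; [easy|]. rewrite ?Rmult_0_l, ?Rplus_0_r. ring.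
  - apply (is_derive_eq _ _ _ _ H2).
    apply (is_derive_ext (fun t => sin (- (s + t * sg)) * (x1 + t * v1) + cos (- (s + t * sg)) * (x2 + t * v2))).
    { intros t. reflexivity. }
    auto_derive; [easy|]. rewrite ?Rmult_0_l, ?Rplus_0_r. ring.
Qed.

Lemma filterdiff_screw tau x dD v : filterdiff (screw tau) (locally x) dD ->
  dD v = (rot tau (fst v), snd v).
Proof.
  intros H. pose proof (filterdiff_directional _ _ _ _ _ v H) as Hd.
  destruct x as [[x1 x2] s], v as [[v1 v2] sg].
  pose proof (is_derive_fst _ _ _ _ _ Hd) as H0. pose proof (is_derive_snd _ _ _ _ _ Hd) as H3.
  pose proof (is_derive_fst _ _ _ _ _ H0) as H1. pose proof (is_derive_snd _ _ _ _ _ H0) as H2.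
  rewrite (surjective_pairing (dD _)), (surjective_pairing (fst (dD _))).
  unfold rot. simpl. f_equal; [f_equal|].
  - apply (is_derive_eq _ _ _ _ H1).
    apply (is_derive_ext (fun t => cos tau * (x1 + t * v1) - sin tau * (x2 + t * v2))).
    { intros t. reflexivity. }
    auto_derive; [easy|]. ring.
  - apply (is_derive_eq _ _ _ _ H2).
    apply (is_derive_ext (fun t => sin tau * (x1 + t * v1) + cos tau * (x2 + t * v2))).
    { intros t. reflexivity. }
    auto_derive; [easy|]. ring.
  - apply (is_derive_eq _ _ _ _ H3).
    apply (is_derive_ext (fun t => (s + t * sg) + tau)).
    { intros t. reflexivity. }
    auto_derive; [easy|]. ring.
Qed.

Lemma filterdiff_id_R2 (z : R2) dD v : filterdiff (fun z : R2 => z) (locally z) dD -> dD v = v.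
Proof.
  intros H. pose proof (filterdiff_directional _ _ _ _ _ v H) as Hd.
  destruct z as [x1 x2], v as [v1 v2].
  pose proof (is_derive_fst _ _ _ _ _ Hd) as H1. pose proof (is_derive_snd _ _ _ _ _ Hd) as H2.
  rewrite (surjective_pairing (dD _)). f_equal.
  - apply (is_derive_eq _ _ _ _ H1).
    apply (is_derive_ext (fun t => x1 + t * v1)); [reflexivity|].
    auto_derive; [easy|]. ring.
  - apply (is_derive_eq _ _ _ _ H2).
    apply (is_derive_ext (fun t => x2 + t * v2)); [reflexivity|].
    auto_derive; [easy|]. ring.
Qed.

(** * Splitting of the product metric *)

Definition dunwind (x v : model_PxS1) : R2 :=
  rot (- snd x) (fst (fst v) + snd v * snd (fst x), snd (fst v) - snd v * fst (fst x)).
(** The inner product with the generator of the S^1-action; see [g_prod_orbit]. *)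
Definition vertical (x v : model_PxS1) : R :=
  sinhc (sq (fst x)) ^ 2 * cross (fst x) (fst v) + snd v.
Definition g_prod : tensor model_PxS1 := fun x v w =>
  radial K_hyp (fst x) (fst v) (fst w) + snd v * snd w.

Lemma met_PxS1 x v w : met (PxS1 g_hyp) x v w = g_prod x v w.
Proof.
  destruct x as [z s], v as [v a], w as [w b]. unfold g_prod. simpl.
  rewrite g_hyp_radial. apply f_equal. ring.
Qed.

Lemma dot_rot t v w : dot (rot t v) (rot t w) = dot v w.
Proof.
  transitivity ((cos t * cos t + sin t * sin t) * dot v w).
  - unfold dot, rot; simpl. ring.
  - rewrite cos2_sin2. ring.
Qed.
Lemma cross_rot t v w : cross (rot t v) (rot t w) = cross v w.
Proof.
  transitivity ((cos t * cos t + sin t * sin t) * cross v w).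
  - unfold cross, rot; simpl. ring.
  - rewrite cos2_sin2. ring.
Qed.
Lemma sq_dot z : sq z = dot z z.
Proof. unfold sq, dot. ring. Qed.
Lemma sq_rot t z : sq (rot t z) = sq z.
Proof. rewrite !sq_dot. apply dot_rot. Qed.
Lemma radial_rot K t z v w : radial K (rot t z) (rot t v) (rot t w) = radial K z v w.
Proof. unfold radial. now rewrite dot_rot, sq_rot, !cross_rot. Qed.

(** The product metric is the pull-back of the cigar metric plus the square of the component along
    the orbit.  Over the squared radius [u], with [S = sinhc u ^ 2 = 1 + u K_hyp u] and
    [C = 1 + u S], both sides agree as polynomials once multiplied by [C]. *)
Lemma g_prod_split x v w :
  g_prod x v w = radial K_cig (unwind x) (dunwind x v) (dunwind x w)
                 + vertical x v * vertical x w / cosh_sq (sq (fst x)).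
Proof.
  unfold unwind, dunwind. rewrite radial_rot.
  destruct x as [z s], v as [v a], w as [w b]. unfold g_prod, vertical; simpl fst; simpl snd.
  pose proof (sq_ge0 z) as Hu. pose proof (cosh_sq_ge1 _ Hu) as HC.
  pose proof (K_hyp_eq (sq z)) as HK.
  unfold radial, K_cig, cosh_sq in *. set (S2 := sinhc (sq z) ^ 2) in *.
  set (G := K_hyp (sq z)) in *.
  unfold sq, dot, cross in *. destruct z as [z1 z2], v as [v1 v2], w as [w1 w2]. simpl fst in *; simpl snd in *.
  rewrite <- HK in HC |- *. field. lra.
Qed.

Lemma g_prod_screw t x v w :
  g_prod (screw t x) (rot t (fst v), snd v) (rot t (fst w), snd w) = g_prod x v w.
Proof. unfold g_prod, screw; simpl. now rewrite radial_rot. Qed.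

(** * Positivity and smoothness of the metrics *)

Lemma radial_sym K z v w : radial K z v w = radial K z w v.
Proof. unfold radial, dot. ring. Qed.

Lemma radial_linear K z (a : R) (v1 v2 w : R2) :
  radial K z (plus (scal a v1) v2) w = a * radial K z v1 w + radial K z v2 w.
Proof.
  destruct z as [z1 z2], v1 as [a1 a2], v2 as [b1 b2], w as [w1 w2].
  change (plus (scal a (a1, a2)) (b1, b2) : R2) with ((a * a1 + b1, a * a2 + b2) : R2).
  unfold radial, dot, cross; simpl. ring.
Qed.

(** The radial component of [v] is no longer than [v]. *)
Lemma radial_ge (K : R -> R) z v : 0 <= 1 + sq z * K (sq z) -> dot z v ^ 2 <= sq z * radial K z v v.
Proof.
  intros H. unfold radial. rewrite Rmult_plus_distr_l, sq_lagrange.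
  pose proof (pow2_ge_0 (cross z v)). nra.
Qed.

Lemma R2_nonzero (v : R2) : v <> zero -> 0 < dot v v.
Proof.
  intros H. rewrite <- sq_dot. destruct (sq_ge0 v) as [H0|H0]; [exact H0|].
  exfalso. apply H. apply sq_eq0. now symmetry.
Qed.

Lemma radial_pos (K : R -> R) z v :
  0 < 1 + sq z * K (sq z) -> v <> zero -> 0 < radial K z v v.
Proof.
  intros HK Hv. pose proof (R2_nonzero v Hv) as Hd.
  destruct (sq_ge0 z) as [Hz|Hz].
  - apply (Rmult_lt_reg_l (sq z)); [exact Hz|]. rewrite Rmult_0_r.
    unfold radial. rewrite Rmult_plus_distr_l, sq_lagrange.
    pose proof (sq_lagrange z v v) as HL.
    assert (0 < sq z * dot v v) by now apply Rmult_lt_0_compat.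
    destruct (Req_dec (cross z v) 0) as [Hc|Hc]; [rewrite Hc in *; nra|].
    assert (0 < cross z v * cross z v) by nra.
    pose proof (Rle_0_sqr (dot z v)) as Hs. unfold Rsqr in Hs. nra.
  - symmetry in Hz. apply sq_eq0 in Hz. subst z. unfold radial, cross; simpl. lra.
Qed.

Lemma radial_hyp_pos z v : v <> zero -> 0 < radial K_hyp z v v.
Proof.
  apply radial_pos. rewrite K_hyp_eq. apply pow_lt, sinhc_pos, sq_ge0.
Qed.

Lemma K_cig_pos z : 0 < 1 + sq z * K_cig (sq z).
Proof.
  pose proof (sq_ge0 z) as Hu. rewrite K_cig_eq by exact Hu.
  apply Rdiv_lt_0_compat; [apply pow_lt, sinhc_pos, Hu|]. pose proof (cosh_sq_ge1 _ Hu). lra.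
Qed.

Lemma radial_cig_pos z v : v <> zero -> 0 < radial K_cig z v v.
Proof. apply radial_pos, K_cig_pos. Qed.

Lemma radial_cig_ge0 z v : 0 <= radial K_cig z v v.
Proof.
  destruct (classic (v = zero)) as [->|H]; [|left; now apply radial_cig_pos].
  right. unfold radial, dot, cross. simpl. change (zero : R) with 0. ring.
Qed.

Lemma smooth_sq (E : NormedModule R_AbsRing) (f : E -> R2) :
  smooth E RN (fun x => fst (f x)) -> smooth E RN (fun x => snd (f x)) ->
  smooth E RN (fun x => sq (f x)).
Proof.
  intros H1 H2. unfold sq.
  apply smooth_Rplus; simpl; (apply smooth_Rmult; [assumption|]);
    (apply smooth_Rmult; [assumption|apply smooth_const]).
Qed.

Lemma smooth_radial (K : R -> R) (E : NormedModule R_AbsRing) (f : E -> R2) (v w : R2) :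
  smooth E RN (fun x => fst (f x)) -> smooth E RN (fun x => snd (f x)) ->
  smooth E RN (fun x => K (sq (f x))) -> smooth E RN (fun x => radial K (f x) v w).
Proof.
  intros H1 H2 HK. unfold radial. apply smooth_Rplus; [apply (smooth_const E RN)|].
  apply smooth_Rmult; [exact HK|]. unfold cross.
  apply smooth_Rmult; apply smooth_Rminus; apply smooth_Rmult; try assumption; apply (smooth_const E RN).
Qed.

Lemma smooth_K_hyp (E : NormedModule R_AbsRing) (f : E -> R) :
  smooth E RN f -> smooth E RN (fun x => K_hyp (f x)).
Proof.
  intros H. apply smooth_Rmult; [now apply smooth_sinhc_slope|].
  apply smooth_Rplus; [now apply smooth_sinhc|apply smooth_const].
Qed.

Lemma smooth_sinhc_sq (E : NormedModule R_AbsRing) (f : E -> R) :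
  smooth E RN f -> smooth E RN (fun x => sinhc (f x) ^ 2).
Proof.
  intros H. apply smooth_Rmult; [now apply smooth_sinhc|].
  apply smooth_Rmult; [now apply smooth_sinhc|apply smooth_const].
Qed.

Lemma smooth_inv_cosh_sq (E : NormedModule R_AbsRing) (f : E -> R) :
  smooth E RN f -> (forall x, 0 <= f x) -> smooth E RN (fun x => / cosh_sq (f x)).
Proof.
  intros H H0. apply smooth_Rinv.
  - unfold cosh_sq. apply smooth_Rplus; [apply smooth_const|].
    apply smooth_Rmult; [exact H|now apply smooth_sinhc_sq].
  - intros x. pose proof (cosh_sq_ge1 _ (H0 x)). lra.
Qed.

Lemma smooth_K_cig (E : NormedModule R_AbsRing) (f : E -> R) :
  smooth E RN f -> (forall x, 0 <= f x) -> smooth E RN (fun x => K_cig (f x)).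
Proof.
  intros H H0. unfold K_cig, Rdiv. apply smooth_Rmult; [|now apply smooth_inv_cosh_sq].
  apply smooth_Rminus; [now apply smooth_K_hyp|now apply smooth_sinhc_sq].
Qed.

Lemma smooth_fst (U V : NormedModule R_AbsRing) :
  smooth (prod_NormedModule R_AbsRing U V) U (fun x => fst x).
Proof. apply smooth_linear, is_linear_fst. Qed.
Lemma smooth_snd (U V : NormedModule R_AbsRing) :
  smooth (prod_NormedModule R_AbsRing U V) V (fun x => snd x).
Proof. apply smooth_linear, is_linear_snd. Qed.

Lemma smooth_fst_fst (U V W : NormedModule R_AbsRing) :
  smooth (prod_NormedModule R_AbsRing (prod_NormedModule R_AbsRing U V) W) U (fun x => fst (fst x)).
Proof.
  apply smooth_linear.
  apply (is_linear_comp (fun x : prod_NormedModule R_AbsRing (prod_NormedModule R_AbsRing U V) W => fst x)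
    (fun x => fst x)); apply is_linear_fst.
Qed.
Lemma smooth_snd_fst (U V W : NormedModule R_AbsRing) :
  smooth (prod_NormedModule R_AbsRing (prod_NormedModule R_AbsRing U V) W) V (fun x => snd (fst x)).
Proof.
  apply smooth_linear.
  apply (is_linear_comp (fun x : prod_NormedModule R_AbsRing (prod_NormedModule R_AbsRing U V) W => fst x)
    (fun x => snd x)); [apply is_linear_fst|apply is_linear_snd].
Qed.

Lemma smooth_unwind : smooth model_PxS1 R2 unwind.
Proof.
  destruct (smooth_cos_sin model_PxS1 (fun x => - snd x)) as [Hc Hs].
  { apply smooth_Ropp. apply (smooth_snd R2 RN). }
  unfold unwind, rot. apply smooth_pair.
  - apply smooth_Rminus; apply smooth_Rmult; try assumption; [apply (smooth_fst_fst RN RN RN)|apply (smooth_snd_fst RN RN RN)].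
  - apply smooth_Rplus; apply smooth_Rmult; try assumption; [apply (smooth_fst_fst RN RN RN)|apply (smooth_snd_fst RN RN RN)].
Qed.

Lemma smooth_screw tau : smooth model_PxS1 model_PxS1 (screw tau).
Proof.
  unfold screw, rot. apply smooth_pair; [apply smooth_pair|].
  - apply smooth_Rminus; apply smooth_Rmult; try apply (smooth_const _ RN); [apply (smooth_fst_fst RN RN RN)|apply (smooth_snd_fst RN RN RN)].
  - apply smooth_Rplus; apply smooth_Rmult; try apply (smooth_const _ RN); [apply (smooth_fst_fst RN RN RN)|apply (smooth_snd_fst RN RN RN)].
  - apply smooth_Rplus; [apply (smooth_snd R2 RN)|apply (smooth_const _ RN)].
Qed.

(** * The quotient by the circle *)

(** The generator of the S^1-action, which spans the kernel of the differential of [unwind]. *)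
Definition orbit_dir (x : model_PxS1) : model_PxS1 := ((- snd (fst x), fst (fst x)), 1).

Lemma dunwind_orbit x : dunwind x (orbit_dir x) = zero.
Proof.
  unfold dunwind, orbit_dir. simpl.
  replace (- snd (fst x) + 1 * snd (fst x)) with 0 by ring.
  replace (fst (fst x) - 1 * fst (fst x)) with 0 by ring.
  change (zero : R2) with ((0, 0) : R2). unfold rot; simpl. apply (f_equal2 pair); ring.
Qed.

Lemma g_prod_orbit x v : g_prod x v (orbit_dir x) = vertical x v.
Proof.
  destruct x as [[x1 x2] s], v as [[v1 v2] a].
  unfold g_prod, vertical, orbit_dir, radial; simpl fst; simpl snd.
  rewrite <- K_hyp_eq. unfold sq, dot, cross; simpl fst; simpl snd. ring.
Qed.

Lemma dunwind_ker x k : dunwind x k = zero -> k = scal (snd k) (orbit_dir x).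
Proof.
  intros H. unfold dunwind in H. apply (f_equal (rot (snd x))) in H.
  rewrite rot_rot in H. replace (snd x + - snd x) with 0 in H by ring. rewrite rot_0 in H.
  change (zero : R2) with ((0, 0) : R2) in H. unfold rot in H. simpl in H.
  rewrite !Rmult_0_r, Rminus_0_r, Rplus_0_r in H. injection H as H1 H2.
  destruct x as [[x1 x2] s], k as [[v1 v2] a]. simpl in *.
  change (((v1, v2), a) = ((a * - x2, a * x1), a * 1) :> model_PxS1).
  apply model_eq; simpl; [apply (f_equal2 pair)|ring]; lra.
Qed.

Lemma radial_scal_r K z v (a : R) w : radial K z v (scal a w) = a * radial K z v w.
Proof. destruct w as [w1 w2]. unfold radial, dot, cross. simpl. change scal with Rmult. ring. Qed.

Lemma g_prod_scal_r x v (a : R) w : g_prod x v (scal a w) = a * g_prod x v w.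
Proof.
  destruct w as [w1 w2]. unfold g_prod. simpl. rewrite radial_scal_r. change scal with Rmult. ring.
Qed.

(** The last coordinate [a] solves [vertical = 0]: it changes the cross product [b] with [c] into
    [b + a u], so that [S (b + a u) + a = 0] with [S = sinhc u ^ 2], that is [a = - S b / (1 + u S)]. *)
Definition horizontal_lift (x : model_PxS1) (w : R2) : model_PxS1 :=
  let c := rot (snd x) w in
  let a := - (sinhc (sq (fst x)) ^ 2 * cross (fst x) c / cosh_sq (sq (fst x))) in
  ((fst c - a * snd (fst x), snd c + a * fst (fst x)), a).

Lemma dunwind_horizontal_lift x w : dunwind x (horizontal_lift x w) = w.
Proof.
  transitivity (rot (- snd x) (rot (snd x) w)).
  - unfold dunwind, horizontal_lift. cbv zeta. apply f_equal. set (c := rot (snd x) w).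
    rewrite (surjective_pairing c). apply (f_equal2 pair); simpl; ring.
  - rewrite rot_rot. replace (- snd x + snd x) with 0 by ring. apply rot_0.
Qed.

Lemma cross_shift (z c : R2) (a : R) :
  cross z (fst c - a * snd z, snd c + a * fst z) = cross z c + a * sq z.
Proof. unfold cross, sq; simpl. ring. Qed.

Lemma vertical_horizontal_lift x w : vertical x (horizontal_lift x w) = 0.
Proof.
  unfold vertical, horizontal_lift. cbv zeta. cbn [fst snd]. rewrite cross_shift.
  pose proof (cosh_sq_ge1 _ (sq_ge0 (fst x))) as HC. unfold cosh_sq in *. field. lra.
Qed.

Lemma horizontal_iff_vertical0 x v :
  (forall k, dunwind x k = zero -> g_prod x v k = 0) <-> vertical x v = 0.
Proof.
  split.
  - intros H. rewrite <- g_prod_orbit. apply H, dunwind_orbit.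
  - intros H k Hk. rewrite (dunwind_ker x k Hk), g_prod_scal_r, g_prod_orbit, H. ring.
Qed.

Lemma unwind_surj z : exists x, unwind x = z.
Proof. exists (z, 0). unfold unwind; simpl. now rewrite Ropp_0, rot_0. Qed.

Lemma is_Upsilon_cigar : is_Upsilon g_hyp (radial K_cig).
Proof.
  split.
  - split; [|split; [|split; [|split]]]; simpl.
    + intros. apply radial_sym.
    + intros. apply radial_linear.
    + intros. now apply radial_cig_pos.
    + intros v w. apply (smooth_radial K_cig R2 (fun z => z)).
      * apply (smooth_fst RN RN).
      * apply (smooth_snd RN RN).
      * apply (smooth_K_cig R2); [|apply sq_ge0].
        apply (smooth_sq R2 (fun z => z)); [apply (smooth_fst RN RN)|apply (smooth_snd RN RN)].
    + intros D HD Hdeck x dD HdD v w.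
      assert (HDid : D = fun z => z).
      { apply functional_extensionality. intros z. specialize (Hdeck z).
        apply ident_eq in Hdeck. rewrite Hdeck, unwind_pt_angle. unfold unwind; simpl.
        now rewrite Ropp_0, rot_0. }
      subst D. now rewrite !(filterdiff_id_R2 x dD).
  - exists unwind. split; [exact smooth_unwind|]. split.
    + intros x. symmetry. apply ident_eq. simpl.
      rewrite unwind_pt_angle. now destruct x.
    + intros x dF HdF.
      assert (HE : forall v, dF v = dunwind x v) by (intros v; apply (filterdiff_unwind x dF v HdF)).
      split.
      * intros w. exists (horizontal_lift x w). rewrite HE. apply dunwind_horizontal_lift.
      * intros v1 v2 H1 H2. rewrite met_PxS1, !HE, g_prod_split.
        assert (Hv : vertical x v1 = 0).
        { apply horizontal_iff_vertical0. intros k Hk. rewrite <- met_PxS1. apply H1. now rewrite HE. }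
        rewrite Hv. simpl. unfold Rdiv. ring.
Qed.

Lemma is_Upsilon_unique h : is_Upsilon g_hyp h -> forall z v w, h z v w = radial K_cig z v w.
Proof.
  intros [_ [F [HF [Hcov HdF]]]] z v w.
  assert (HFu : F = unwind).
  { apply functional_extensionality. intros x. specialize (Hcov x). symmetry in Hcov.
    apply ident_eq in Hcov. rewrite Hcov. simpl. rewrite unwind_pt_angle. now destruct x. }
  subst F. destruct (HF 1%nat) as [dF [HdF1 _]].
  destruct (unwind_surj z) as [x <-].
  destruct (HdF x (dF x) (HdF1 x)) as [_ H].
  assert (HE : forall v, dF x v = dunwind x v) by (intros u; apply (filterdiff_unwind x _ u (HdF1 x))).
  specialize (H (horizontal_lift x v) (horizontal_lift x w)).
  rewrite !HE, !dunwind_horizontal_lift in H.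
  transitivity (met (PxS1 g_hyp) x (horizontal_lift x v) (horizontal_lift x w)).
  - apply H; intros k Hk; rewrite met_PxS1;
      (apply horizontal_iff_vertical0; [apply vertical_horizontal_lift|now rewrite <- HE]).
  - rewrite met_PxS1, g_prod_split, !dunwind_horizontal_lift, !vertical_horizontal_lift. unfold Rdiv. ring.
Qed.

(** * The cigar *)

Lemma cigar_polar_eq z : cigar_polar z = (arcsinhc (sq z) * fst z, arcsinhc (sq z) * snd z).
Proof.
  unfold cigar_polar. rewrite arcsinh_arcsinhc, rho_sq.
  destruct (Req_dec (rho z) 0) as [H|H].
  - assert (Hz : z = (0, 0)) by (apply sq_eq0; rewrite <- rho_sq, H; ring).
    subst z. simpl. now rewrite !Rmult_0_r.
  - replace (rho z * arcsinhc (sq z) / rho z) with (arcsinhc (sq z)) by (field; exact H). reflexivity.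
Qed.

Definition cigar_polar_inv (z : R2) : R2 := (sinhc (sq z) * fst z, sinhc (sq z) * snd z).

Lemma sq_scal (a : R) (z : R2) : sq (a * fst z, a * snd z) = a ^ 2 * sq z.
Proof. unfold sq; simpl. ring. Qed.

Lemma sinhc_arcsinhc u : 0 < u -> arcsinhc u * sinhc (arcsinhc u ^ 2 * u) = 1.
Proof.
  intros Hu. pose proof (sqrt_lt_R0 u Hu) as Hs. set (x := sqrt u) in *.
  assert (Hx : x ^ 2 = u) by (apply pow2_sqrt; lra).
  pose proof (sinh_arcsinh x) as H. rewrite arcsinh_arcsinhc, sinh_sinhc, Hx in H.
  replace ((x * arcsinhc u) ^ 2) with (arcsinhc u ^ 2 * u) in H by (rewrite <- Hx; ring).
  apply (Rmult_eq_reg_l x); lra.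
Qed.

Lemma arcsinhc_sinhc u : 0 < u -> sinhc u * arcsinhc (sinhc u ^ 2 * u) = 1.
Proof.
  intros Hu. pose proof (sqrt_lt_R0 u Hu) as Hs. set (x := sqrt u) in *.
  assert (Hx : x ^ 2 = u) by (apply pow2_sqrt; lra).
  pose proof (arcsinh_sinh x) as H. rewrite sinh_sinhc, arcsinh_arcsinhc, Hx in H.
  replace ((x * sinhc u) ^ 2) with (sinhc u ^ 2 * u) in H by (rewrite <- Hx; ring).
  apply (Rmult_eq_reg_l x); lra.
Qed.

Lemma cigar_polar_invl z : cigar_polar_inv (cigar_polar z) = z.
Proof.
  rewrite cigar_polar_eq. unfold cigar_polar_inv. rewrite sq_scal. cbn [fst snd].
  destruct (sq_ge0 z) as [Hz|Hz].
  - pose proof (sinhc_arcsinhc _ Hz) as H. destruct z as [a b]. cbn [fst snd].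
    rewrite <- !Rmult_assoc, (Rmult_comm (sinhc _)), H. now rewrite !Rmult_1_l.
  - symmetry in Hz. apply sq_eq0 in Hz. subst z. cbn [fst snd]. now rewrite !Rmult_0_r.
Qed.

Lemma cigar_polar_invr z : cigar_polar (cigar_polar_inv z) = z.
Proof.
  rewrite cigar_polar_eq. unfold cigar_polar_inv. rewrite sq_scal. cbn [fst snd].
  destruct (sq_ge0 z) as [Hz|Hz].
  - pose proof (arcsinhc_sinhc _ Hz) as H. destruct z as [a b]. cbn [fst snd].
    rewrite <- !Rmult_assoc, (Rmult_comm (arcsinhc _)), H. now rewrite !Rmult_1_l.
  - symmetry in Hz. apply sq_eq0 in Hz. subst z. cbn [fst snd]. now rewrite !Rmult_0_r.
Qed.

Lemma smooth_scaling (phi : R2 -> R) : smooth R2 RN phi ->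
  smooth R2 R2 (fun z => (phi z * fst z, phi z * snd z)).
Proof.
  intros H. apply smooth_pair; apply smooth_Rmult; try exact H;
    [apply (smooth_fst RN RN)|apply (smooth_snd RN RN)].
Qed.

Lemma smooth_sq_R2 : smooth R2 RN sq.
Proof. apply (smooth_sq R2 (fun z => z)); [apply (smooth_fst RN RN)|apply (smooth_snd RN RN)]. Qed.

Lemma filterdiff_cigar_polar z df v : filterdiff cigar_polar (locally z) df ->
  df v = (arcsinhc (sq z) * fst v + 2 * arcsinhc_tower 1 (sq z) * dot z v * fst z,
          arcsinhc (sq z) * snd v + 2 * arcsinhc_tower 1 (sq z) * dot z v * snd z).
Proof.
  intros H. pose proof (filterdiff_directional _ _ _ _ _ v H) as Hd.
  destruct z as [x1 x2], v as [v1 v2].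
  pose proof (is_derive_fst _ _ _ _ _ Hd) as H1. pose proof (is_derive_snd _ _ _ _ _ Hd) as H2.
  assert (Hq : is_derive (fun t => sq (x1 + t * v1, x2 + t * v2)) 0 (2 * dot (x1, x2) (v1, v2))).
  { unfold sq, dot; cbn [fst snd]. auto_derive; [easy|]. simpl. ring. }
  assert (Ha : is_derive (fun t => arcsinhc (sq (x1 + t * v1, x2 + t * v2))) 0
            (2 * dot (x1, x2) (v1, v2) * arcsinhc_tower 1 (sq (x1, x2)))).
  { apply (is_derive_comp arcsinhc); [|exact Hq]. rewrite !Rmult_0_l, !Rplus_0_r.
    apply (arcsinhc_tower_deriv 0). pose proof (sq_ge0 (x1, x2)). lra. }
  rewrite (surjective_pairing (df _)). apply (f_equal2 pair).
  - apply (is_derive_eq _ _ _ _ H1).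
    apply (is_derive_ext (fun t => arcsinhc (sq (x1 + t * v1, x2 + t * v2)) * (x1 + t * v1))).
    { intros t. rewrite cigar_polar_eq. reflexivity. }
    evar_last.
    + apply Derive.is_derive_mult; [exact Ha|]. auto_derive; [easy|]. reflexivity.
    + cbn [fst snd]. rewrite !Rmult_0_l, !Rplus_0_r. unfold dot, sq. cbn [fst snd]. ring.
  - apply (is_derive_eq _ _ _ _ H2).
    apply (is_derive_ext (fun t => arcsinhc (sq (x1 + t * v1, x2 + t * v2)) * (x2 + t * v2))).
    { intros t. rewrite cigar_polar_eq. reflexivity. }
    evar_last.
    + apply Derive.is_derive_mult; [exact Ha|]. auto_derive; [easy|]. reflexivity.
    + cbn [fst snd]. rewrite !Rmult_0_l, !Rplus_0_r. unfold dot, sq. cbn [fst snd]. ring.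
Qed.

(** After multiplication by [u] both sides become combinations of the products of the radial and of
    the angular components: the radial coefficient is [(A + 2 u A')^2 = 1 / (1 + u)] by
    [arcsinhc_ode], the angular one is [tanh (arcsinh r)^2 / u = 1 / (1 + u)]. *)
Lemma cigar_isometry : riem_isometry g_cigar (rot_metric tanh) cigar_polar.
Proof.
  exists cigar_polar_inv. split; [|split; [|split; [|split]]].
  - replace cigar_polar with (fun z => (arcsinhc (sq z) * fst z, arcsinhc (sq z) * snd z) : R2)
      by (apply functional_extensionality; intros z; symmetry; apply cigar_polar_eq).
    apply smooth_scaling, smooth_arcsinhc; [exact smooth_sq_R2|exact sq_ge0].
  - apply (smooth_scaling (fun z => sinhc (sq z))), smooth_sinhc, smooth_sq_R2.
  - exact cigar_polar_invl.
  - exact cigar_polar_invr.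
  - intros z df Hdf v w. rewrite rot_tanh_radial, !(filterdiff_cigar_polar z df _ Hdf), cigar_polar_eq.
    pose proof (sq_ge0 z) as Hu. pose proof (arcsinhc_ode _ Hu) as Hode.
    assert (Hg : g_cigar z v w = dot v w / (1 + sq z)) by (unfold g_cigar, sq; now rewrite Rplus_assoc).
    rewrite Hg. set (A := arcsinhc (sq z)) in *. set (A' := arcsinhc_tower 1 (sq z)) in *.
    assert (HA : (A + 2 * sq z * A') ^ 2 = / (1 + sq z)).
    { rewrite Hode, pow_inv. f_equal. apply pow2_sqrt. lra. }
    unfold radial. rewrite sq_scal.
    pose proof (K_cig_eq (A ^ 2 * sq z)) as HK. set (K := K_cig (A ^ 2 * sq z)) in *.
    set (LHS := dot _ _ + _).
    assert (HL : LHS = A ^ 2 * dot v w + (4 * A * A' + 4 * A' ^ 2 * sq z) * (dot z v * dot z w)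
        + K * A ^ 4 * (cross z v * cross z w)).
    { unfold LHS, dot, cross, sq; cbn [fst snd]. ring. }
    rewrite HL. clear HL LHS.
    destruct Hu as [Hu|Hu].
    + assert (HT : A ^ 2 * (1 + A ^ 2 * sq z * K) = / (1 + sq z)).
      { rewrite HK by (pose proof (pow2_ge_0 A); nra).
        pose proof (sinhc_arcsinhc _ Hu) as HS. fold A in HS.
        unfold cosh_sq. set (S := sinhc (A ^ 2 * sq z)) in *.
        assert (HSA : A ^ 2 * S ^ 2 = 1) by (replace (A ^ 2 * S ^ 2) with ((A * S) ^ 2) by ring; rewrite HS; ring).
        replace (1 + A ^ 2 * sq z * S ^ 2) with (1 + sq z * (A ^ 2 * S ^ 2)) by ring.
        rewrite HSA. unfold Rdiv. rewrite <- Rmult_assoc, HSA. rewrite Rmult_1_r. ring. }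
      apply (Rmult_eq_reg_l (sq z)); [|lra].
      replace (sq z * (dot v w / (1 + sq z))) with ((sq z * dot v w) * / (1 + sq z)) by (unfold Rdiv; ring).
      transitivity (A ^ 2 * (sq z * dot v w) + (4 * A * A' * sq z + 4 * A' ^ 2 * sq z ^ 2) * (dot z v * dot z w)
        + (sq z * K * A ^ 4) * (cross z v * cross z w)); [ring|].
      rewrite sq_lagrange.
      transitivity ((A + 2 * sq z * A') ^ 2 * (dot z v * dot z w)
        + A ^ 2 * (1 + A ^ 2 * sq z * K) * (cross z v * cross z w)); [ring|].
      rewrite HA, HT. ring.
    + assert (Hz : z = (0, 0)) by (apply sq_eq0; now symmetry).
      rewrite <- Hu, Rmult_0_r, Rmult_0_l, Rplus_0_r in HA.
      rewrite <- Hu, Rplus_0_r. rewrite HA, Rplus_0_r. subst z.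
      unfold dot, cross; cbn [fst snd]. field.
Qed.

(** * The quotients by finite cyclic groups *)

Lemma zp_angle_eq p k l : (0 < p)%nat -> Rabs (zp_angle p k - zp_angle p l) < 2 * PI / INR p -> k = l.
Proof.
  intros Hp H. assert (HP : 0 < INR p) by (apply lt_0_INR; lia). pose proof PI_RGT_0.
  unfold zp_angle in H.
  replace (2 * PI * IZR k / INR p - 2 * PI * IZR l / INR p) with (IZR (k - l) * (2 * PI / INR p)) in H
    by (rewrite minus_IZR; field; lra).
  assert (Hc : 0 < 2 * PI / INR p) by (apply Rdiv_lt_0_compat; lra).
  rewrite Rabs_mult, (Rabs_pos_eq (2 * PI / INR p)) in H by lra.
  assert (H1 : Rabs (IZR (k - l)) < 1) by (apply (Rmult_lt_reg_r (2 * PI / INR p)); lra).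
  rewrite <- abs_IZR in H1. apply (lt_IZR _ 1) in H1. lia.
Qed.

(** The angle of a deck transformation is continuous with values in [(2 pi / p) Z], hence locally
    constant. *)
Lemma deck_locally p (D : model_PxS1 -> model_PxS1) x : (0 < p)%nat ->
  (forall y, cov_Zp p y = cov_Zp p (D y)) -> continuous D x ->
  exists k, D x = screw (zp_angle p k) x /\ locally x (fun y => screw (zp_angle p k) y = D y).
Proof.
  intros Hp HD Hc.
  assert (HD' : forall y, exists k, D y = screw (zp_angle p k) y) by (intros y; now apply cov_Zp_eq).
  destruct (HD' x) as [k Hk]. exists k. split; [exact Hk|].
  assert (HP : 0 < 2 * PI / INR p).
  { pose proof PI_RGT_0. apply Rdiv_lt_0_compat; [lra|apply lt_0_INR; lia]. }
  assert (Hd : continuous (fun y => snd (D y) - snd y) x).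
  { apply (continuous_minus (fun y => snd (D y)) (fun y => snd y) x).
    - apply (continuous_comp D snd x Hc). apply continuous_snd.
    - apply continuous_snd. }
  specialize (Hd (ball (snd (D x) - snd x) (2 * PI / INR p)) (locally_ball _ (mkposreal _ HP))).
  revert Hd. unfold filtermap. apply filter_imp. intros y Hy. destruct (HD' y) as [l Hl].
  replace k with l; [now symmetry|].
  apply (zp_angle_eq p l k Hp).
  rewrite Hk, Hl in Hy. unfold screw in Hy. simpl in Hy.
  unfold ball in Hy. simpl in Hy. unfold AbsRing_ball, abs, minus, plus, opp in Hy. simpl in Hy.
  replace (zp_angle p l - zp_angle p k) with (snd y + zp_angle p l - snd y + - (snd x + zp_angle p k - snd x)) by ring.
  exact Hy.
Qed.

Lemma deck_differential p (D : model_PxS1 -> model_PxS1) x dD : (0 < p)%nat ->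
  (forall y, cov_Zp p y = cov_Zp p (D y)) -> filterdiff D (locally x) dD ->
  exists k, D x = screw (zp_angle p k) x /\ forall v, dD v = (rot (zp_angle p k) (fst v), snd v).
Proof.
  intros Hp HD HdD.
  destruct (deck_locally p D x Hp HD) as [k [H1 H2]].
  { apply filterdiff_continuous. now exists dD. }
  exists k. split; [exact H1|]. intros v. apply (filterdiff_screw _ x).
  apply (filterdiff_ext_locally D); [|exact HdD]. revert H2. apply filter_imp. congruence.
Qed.

Lemma rot_zero t : rot t zero = zero.
Proof.
  change (zero : R2) with ((0, 0) : R2). unfold rot; simpl. apply (f_equal2 pair); ring.
Qed.

Lemma g_prod_sym x v w : g_prod x v w = g_prod x w v.
Proof. unfold g_prod. rewrite radial_sym. ring. Qed.

Lemma smooth_g_prod v w : smooth model_PxS1 RN (fun x => g_prod x v w).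
Proof.
  unfold g_prod. apply (smooth_Rplus model_PxS1 (fun x => radial K_hyp (fst x) (fst v) (fst w)));
    [|apply (smooth_const _ RN)].
  apply (smooth_radial K_hyp model_PxS1 (fun x => fst x)).
  - apply (smooth_fst_fst RN RN RN).
  - apply (smooth_snd_fst RN RN RN).
  - apply (smooth_K_hyp model_PxS1). apply (smooth_sq model_PxS1 (fun x => fst x)).
    + apply (smooth_fst_fst RN RN RN).
    + apply (smooth_snd_fst RN RN RN).
Qed.

Lemma g_prod_pos x v : v <> zero -> 0 < g_prod x v v.
Proof.
  intros Hv. destruct v as [v a]. unfold g_prod; cbn [fst snd].
  destruct (classic (v = zero)) as [->|H].
  - assert (Ha : a <> 0) by (intros ->; now apply Hv).
    assert (Hr : radial K_hyp (fst x) zero zero = 0).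
    { unfold radial, dot, cross. simpl. change (zero : R) with 0. ring. }
    rewrite Hr. nra.
  - pose proof (radial_hyp_pos (fst x) v H). nra.
Qed.

Lemma is_Zp_quotient_metric_g_prod p : (0 < p)%nat -> is_Zp_quotient_metric p g_hyp g_prod.
Proof.
  intros Hp. split.
  - split; [|split; [|split; [|split]]]; simpl.
    + apply g_prod_sym.
    + intros x a [v1 a1] [v2 a2] w. unfold g_prod.
      change (plus (scal a (v1, a1)) (v2, a2) : model_PxS1)
        with ((plus (scal a v1) v2, a * a1 + a2) : model_PxS1).
      cbn [fst snd]. rewrite radial_linear. ring.
    + intros. now apply g_prod_pos.
    + apply smooth_g_prod.
    + intros D HD Hdeck x dD HdD v w.
      destruct (deck_differential p D x dD Hp) as [k [Hx Hv]]; [intros y; symmetry; apply Hdeck|exact HdD|].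
      rewrite Hx, !Hv. apply g_prod_screw.
  - exists (fun x => x). split; [|split].
    + apply smooth_linear, is_linear_id.
    + reflexivity.
    + intros x dF HdF.
      assert (HE : forall v, dF v = v).
      { intros v. rewrite (filterdiff_screw 0 x dF v).
        - rewrite rot_0. now destruct v.
        - apply (filterdiff_ext (fun x => x)); [intros y; symmetry; apply screw_0|exact HdF]. }
      split.
      * intros w. exists w. apply HE.
      * intros v1 v2 _ _. rewrite !HE, met_PxS1. reflexivity.
Qed.

(** A lift of the projection is near [x] a deck transformation by some angle [t], hence [h] at the
    image of [x] is the product metric there; the invariance of [h] under the same screw motion brings
    this back to [x]. *)
Lemma is_Zp_quotient_metric_unique p h : (0 < p)%nat -> is_Zp_quotient_metric p g_hyp h ->
  forall x v w, h x v w = g_prod x v w.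
Proof.
  intros Hp [[_ [_ [_ [_ Hdeck]]]] [F [HF [Hcov HdF]]]] x v w.
  destruct (HF 1%nat) as [dF [HdF1 _]].
  destruct (deck_differential p F x (dF x) Hp) as [k [Hx Hv]]; [exact Hcov|apply HdF1|].
  set (t := zp_angle p k) in *.
  assert (Hinj : forall k, dF x k = zero -> k = zero).
  { intros l Hl. rewrite Hv in Hl.
    pose proof (f_equal (fun q : model_PxS1 => rot (- t) (fst q)) Hl) as H1. pose proof (f_equal snd Hl) as H2.
    cbn [fst snd] in H1, H2. rewrite rot_rot in H1. replace (- t + t) with 0 in H1 by ring.
    rewrite rot_0 in H1. destruct l as [l a]. cbn [fst snd] in *. rewrite H1, H2.
    apply model_eq; [apply rot_zero|reflexivity]. }
  destruct (HdF x (dF x) (HdF1 x)) as [_ H].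
  specialize (H v w).
  destruct (smooth_screw t 1%nat) as [dS [HS _]].
  pose proof (Hdeck (screw t) (smooth_screw t)) as Hd. simpl in Hd.
  specialize (Hd (fun y => eq_sym (proj2 (cov_Zp_eq p y (screw t y) Hp) (ex_intro _ k eq_refl))) x (dS x) (HS x) v w).
  rewrite !(filterdiff_screw t x (dS x) _ (HS x)) in Hd.
  rewrite <- Hd, <- Hx, <- met_PxS1, <- !Hv. apply H.
  - intros l Hl. rewrite (Hinj l Hl), met_PxS1, g_prod_sym. unfold g_prod, radial, dot, cross. simpl.
    change (zero : R) with 0. ring.
  - intros l Hl. rewrite (Hinj l Hl), met_PxS1, g_prod_sym. unfold g_prod, radial, dot, cross. simpl.
    change (zero : R) with 0. ring.
Qed.

(** * Lengths and distances *)

(** This makes the speed of a C^1 curve integrable; the integral in the length of a curve is a total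
    function and says nothing otherwise. *)
Definition continuous_met (M : mfd) : Prop := forall c c' : R -> model M,
  (forall t, is_derive c t (c' t)) -> (forall t, continuous c' t) ->
  forall t, continuous (fun t => met M (c t) (c' t) (c' t)) t.

Definition speed (M : mfd) (c c' : R -> model M) (t : R) : R := sqrt (met M (c t) (c' t) (c' t)).

Lemma speed_integrable (M : mfd) (c c' : R -> model M) : continuous_met M ->
  (forall t, is_derive c t (c' t)) -> (forall t, continuous c' t) ->
  ex_RInt (speed M c c') 0 1.
Proof.
  intros HM H1 H2. apply (ex_RInt_continuous (V := R_CompleteNormedModule)). intros t _.
  apply (continuous_comp (fun t => met M (c t) (c' t) (c' t)) sqrt); [now apply HM|apply continuous_sqrt].
Qed.

Lemma pw_path_nonneg (M : mfd) x y L : continuous_met M -> pw_path M x y L -> 0 <= L.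
Proof.
  intros HM H. induction H as [x|c c' y L H1 H2 _ IH]; [lra|].
  apply Rplus_le_le_0_compat; [|exact IH].
  apply RInt_ge_0; [lra|now apply (speed_integrable M)|]. intros; apply sqrt_pos.
Qed.

Lemma pw_path_app (M : mfd) x y z L1 L2 :
  pw_path M x y L1 -> pw_path M y z L2 -> pw_path M x z (L1 + L2).
Proof.
  intros H H2. induction H as [x|c c' y L Hc1 Hc2 _ IH].
  - now rewrite Rplus_0_l.
  - rewrite Rplus_assoc. apply pw_cons; auto.
Qed.

Lemma pw_path_1 (M : mfd) (c c' : R -> model M) :
  (forall t, is_derive c t (c' t)) -> (forall t, continuous c' t) ->
  pw_path M (cov M (c 0)) (cov M (c 1)) (RInt (speed M c c') 0 1).
Proof.
  intros H1 H2. rewrite <- (Rplus_0_r (RInt _ _ _)). apply pw_cons; auto. constructor.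
Qed.

(** A segment of the model: any two points are joined by some curve, so the infimum that defines
    the distance is finite. *)
Lemma pw_path_segment (M : mfd) (x y : model M) : exists L, pw_path M (cov M x) (cov M y) L.
Proof.
  set (c := fun t : R => plus x (scal t (minus y x))).
  assert (H0 : c 0 = x).
  { unfold c. rewrite (scal_zero_l (minus y x) : scal 0 _ = zero). apply plus_zero_r. }
  assert (H1 : c 1 = y).
  { transitivity (plus x (minus y x)); [exact (f_equal (plus x) (scal_one (minus y x)))|].
    unfold minus. rewrite (plus_comm y). rewrite plus_assoc.
    transitivity (plus zero y); [|apply plus_zero_l].
    exact (f_equal (fun z => plus z y) (plus_opp_r x)). }
  rewrite <- H0, <- H1. eexists. apply (pw_path_1 M c (fun _ => minus y x)).
  - intros t. unfold c. evar_last.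
    + apply (is_derive_plus (V := model M) (fun _ => x)); [apply is_derive_const|].
      apply (is_derive_scal_l (V := model M) (fun t : R => t)). apply is_derive_id.
    + rewrite plus_zero_l. apply scal_one.
  - intros t. apply continuous_const.
Qed.

Definition surjective_cov (M : mfd) : Prop := forall q, exists x, cov M x = q.

(** The distance is the greatest lower bound of the lengths, in the real numbers. *)
Lemma riem_dist_glb (M : mfd) x y : continuous_met M -> surjective_cov M ->
  (forall L, pw_path M x y L -> riem_dist M x y <= L) /\
  (forall m, (forall L, pw_path M x y L -> m <= L) -> m <= riem_dist M x y).
Proof.
  intros HM Hs. unfold riem_dist.
  destruct (Hs x) as [x0 <-], (Hs y) as [y0 <-]. destruct (pw_path_segment M x0 y0) as [L0 HL0].
  destruct (Glb_Rbar_correct (pw_path M (cov M x0) (cov M y0))) as [Hlb Hglb].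
  pose proof (Hlb _ HL0) as HL.
  assert (H0 : Rbar_le 0 (Glb_Rbar (pw_path M (cov M x0) (cov M y0)))).
  { apply Hglb. intros L HLL. simpl. exact (pw_path_nonneg M (cov M x0) (cov M y0) L HM HLL). }
  destruct (Glb_Rbar _) as [l| |]; try easy. split.
  - intros L HLL. apply (Hlb L HLL).
  - intros m Hm. apply (Hglb (Finite m)). intros L HLL. now apply Hm.
Qed.

Lemma riem_dist_self (M : mfd) x : continuous_met M -> surjective_cov M -> riem_dist M x x = 0.
Proof.
  intros HM Hs. destruct (riem_dist_glb M x x HM Hs) as [H1 H2]. apply Rle_antisym.
  - apply H1. constructor.
  - apply H2. intros L. now apply pw_path_nonneg.
Qed.

Lemma continuous_pair (T : UniformSpace) (U V : NormedModule R_AbsRing) (f : T -> U) (g : T -> V) x :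
  continuous f x -> continuous g x ->
  continuous (fun t => (f t, g t) : prod_NormedModule R_AbsRing U V) x.
Proof.
  intros Hf Hg.
  apply (continuous_comp_2 f g (fun u v => (u, v) : prod_NormedModule R_AbsRing U V)); try assumption.
  apply (continuous_ext (fun t => t)); [ now intros [a b] | apply continuous_id ].
Qed.

Lemma cont_fst (U V : NormedModule R_AbsRing) (f : R -> prod_NormedModule R_AbsRing U V) t :
  continuous f t -> continuous (fun t => fst (f t)) t.
Proof. intros H. apply (continuous_comp f (fun p => fst p) t H). apply continuous_fst. Qed.
Lemma cont_snd (U V : NormedModule R_AbsRing) (f : R -> prod_NormedModule R_AbsRing U V) t :
  continuous f t -> continuous (fun t => snd (f t)) t.
Proof. intros H. apply (continuous_comp f (fun p => snd p) t H). apply continuous_snd. Qed.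
Lemma cont_Rplus (f g : R -> R) t : continuous f t -> continuous g t -> continuous (fun t => f t + g t) t.
Proof. apply (continuous_plus f g). Qed.
Lemma cont_Rminus (f g : R -> R) t : continuous f t -> continuous g t -> continuous (fun t => f t - g t) t.
Proof. apply (continuous_minus f g). Qed.
Lemma cont_Ropp (f : R -> R) t : continuous f t -> continuous (fun t => - f t) t.
Proof. apply (continuous_opp f). Qed.
Lemma cont_Rmult (f g : R -> R) t : continuous f t -> continuous g t -> continuous (fun t => f t * g t) t.
Proof. apply (continuous_mult f g). Qed.
Lemma cont_cos (f : R -> R) t : continuous f t -> continuous (fun t => cos (f t)) t.
Proof. intros H. apply (continuous_comp f cos); [exact H|apply continuous_cos]. Qed.
Lemma cont_sin (f : R -> R) t : continuous f t -> continuous (fun t => sin (f t)) t.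
Proof. intros H. apply (continuous_comp f sin); [exact H|apply continuous_sin]. Qed.

(** Selects the rule from the head symbol: letting unification try each rule would unfold the
    trigonometric functions. *)
Ltac cont := lazymatch goal with
  | |- continuous (fun t => Rplus (@?f t) (@?g t)) _ => apply (cont_Rplus f g); cont
  | |- continuous (fun t => Rminus (@?f t) (@?g t)) _ => apply (cont_Rminus f g); cont
  | |- continuous (fun t => Rmult (@?f t) (@?g t)) _ => apply (cont_Rmult f g); cont
  | |- continuous (fun t => Ropp (@?f t)) _ => apply (cont_Ropp f); cont
  | |- continuous (fun t => cos (@?f t)) _ => apply (cont_cos f); cont
  | |- continuous (fun t => sin (@?f t)) _ => apply (cont_sin f); cont
  | |- _ => first [assumption | apply continuous_const]
  end.

Lemma continuous_rot (s : R -> R) (z : R -> R2) t : continuous s t -> continuous z t ->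
  continuous (fun t => rot (s t) (z t)) t.
Proof.
  intros Hs Hz. pose proof (cont_fst _ _ z t Hz). pose proof (cont_snd _ _ z t Hz).
  unfold rot. apply (continuous_pair _ RN RN); cont.
Qed.

Lemma continuous_radial (K : R -> R) (z v : R -> R2) t :
  smooth R2 RN (fun z => K (sq z)) -> continuous z t -> continuous v t ->
  continuous (fun t => radial K (z t) (v t) (v t)) t.
Proof.
  intros HK Hz Hv.
  pose proof (cont_fst _ _ z t Hz). pose proof (cont_snd _ _ z t Hz).
  pose proof (cont_fst _ _ v t Hv). pose proof (cont_snd _ _ v t Hv).
  assert (continuous (fun t => K (sq (z t))) t).
  { apply (continuous_comp z (fun z => K (sq z))); [exact Hz|apply (HK 0%nat)]. }
  unfold radial, dot, cross. cont.
Qed.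

Lemma smooth_K_hyp_sq : smooth R2 RN (fun z => K_hyp (sq z)).
Proof. apply smooth_K_hyp, smooth_sq_R2. Qed.
Lemma smooth_K_cig_sq : smooth R2 RN (fun z => K_cig (sq z)).
Proof. apply smooth_K_cig; [exact smooth_sq_R2|exact sq_ge0]. Qed.

Lemma is_derive_cont (V : NormedModule R_AbsRing) (c : R -> V) t l : is_derive c t l -> continuous c t.
Proof. intros H. apply (ex_derive_continuous (V := V)). now exists l. Qed.

(** * Comparison of the distances *)

Definition cigar : mfd := plane (radial K_cig).
Definition Zp_space (p : nat) : mfd := Zp_quotient p g_prod.

Lemma continuous_met_cigar : continuous_met cigar.
Proof.
  intros c c' H1 H2 t. apply continuous_radial; [exact smooth_K_cig_sq|apply (is_derive_cont R2 c t _ (H1 t))|apply H2].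
Qed.

Lemma continuous_met_Zp p : continuous_met (Zp_space p).
Proof.
  intros c c' H1 H2 t. unfold Zp_space, Zp_quotient, g_prod; cbn [met model] in *.
  pose proof (is_derive_cont model_PxS1 c t _ (H1 t)) as Hc. specialize (H2 t).
  pose proof (cont_snd _ _ c' t H2).
  apply cont_Rplus; [|cont].
  apply (continuous_radial K_hyp (fun t => fst (c t)) (fun t => fst (c' t))).
  - exact smooth_K_hyp_sq.
  - now apply (cont_fst R2 RN).
  - now apply (cont_fst R2 RN).
Qed.

Lemma surjective_cov_cigar : surjective_cov cigar.
Proof. intros z. now exists z. Qed.
Lemma surjective_cov_Zp p : surjective_cov (Zp_space p).
Proof. intros q. destruct (cov_Zp_surj p q) as [x Hx]. now exists x. Qed.

Lemma is_derive_filterdiff_comp (U V : NormedModule R_AbsRing) (c : R -> U) (f : U -> V) t l df :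
  is_derive c t l -> filterdiff f (locally (c t)) df -> is_derive (fun t => f (c t)) t (df l).
Proof.
  intros Hc Hf. pose proof (filterdiff_comp' c f t _ df Hc Hf) as H.
  eapply filterdiff_ext_lin; [exact H|]. intros y. destruct Hf as [Hl _]. simpl. apply (linear_scal _ Hl).
Qed.

(** The approximation used for the convergence: the map of quotients induced by [unwind]. *)
Definition to_cigar (p : nat) (q : quot (orb_Zp p)) : R2 := unwind_pt (repr q).

Lemma to_cigar_cov p x : (0 < p)%nat -> to_cigar p (cov_Zp p x) = unwind x.
Proof.
  intros Hp. unfold to_cigar. set (m := repr (cov_Zp p x)).
  assert (Hm : cls (orb_Zp p) m = cov_Zp p x) by apply cls_repr. clearbody m.
  destruct m as [z sg]. destruct (angle_surj sg) as [s ->]. rewrite unwind_pt_angle.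
  change (cov_Zp p (z, s) = cov_Zp p x) in Hm. apply cov_Zp_eq in Hm; [|exact Hp].
  destruct Hm as [k ->]. now rewrite unwind_screw.
Qed.

(** By [g_prod_split] the unwound curve is nowhere faster. *)
Lemma project_path p a b L : (0 < p)%nat -> pw_path (Zp_space p) a b L ->
  exists L', pw_path cigar (to_cigar p a) (to_cigar p b) L' /\ L' <= L.
Proof.
  intros Hp H. induction H as [x|c c' y L H1 H2 _ [L' [IH1 IH2]]].
  - exists 0. split; [apply (pw_nil cigar)|lra].
  - cbn [cov Zp_space Zp_quotient] in *. rewrite to_cigar_cov in IH1 |- * by exact Hp.
    cbn [model Zp_space Zp_quotient] in c, c'.
    set (e := fun t => unwind (c t)). set (e' := fun t => dunwind (c t) (c' t)).
    assert (He1 : forall t, is_derive e t (e' t)).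
    { intros t. destruct (smooth_unwind 1%nat) as [dF [HdF _]].
      unfold e'. change (is_derive e t (dunwind (c t) (c' t))). unfold dunwind.
      rewrite <- (filterdiff_unwind (c t) (dF (c t)) (c' t) (HdF (c t))).
      apply (is_derive_filterdiff_comp model_PxS1 R2 c unwind); [apply H1|apply HdF]. }
    assert (He2 : forall t, continuous e' t).
    { intros t. specialize (H2 t). pose proof (is_derive_cont model_PxS1 c t _ (H1 t)) as Hc.
      pose proof (cont_fst R2 RN c t Hc) as Hc1. pose proof (cont_snd R2 RN c t Hc) as Hc2.
      pose proof (cont_fst R2 RN c' t H2) as Hd1. pose proof (cont_snd R2 RN c' t H2) as Hd2.
      pose proof (cont_fst RN RN _ t Hc1). pose proof (cont_snd RN RN _ t Hc1).
      pose proof (cont_fst RN RN _ t Hd1). pose proof (cont_snd RN RN _ t Hd1).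
      unfold e', dunwind. apply continuous_rot; [cont|]. apply (continuous_pair _ RN RN); cont. }
    exists (RInt (speed cigar e e') 0 1 + L'). split.
    + apply (@pw_cons cigar e e'); assumption.
    + apply Rplus_le_compat; [|exact IH2]. apply RInt_le; [lra| | |].
      * apply speed_integrable; [exact continuous_met_cigar|exact He1|exact He2].
      * apply (speed_integrable (Zp_space p)); [apply continuous_met_Zp|exact H1|exact H2].
      * intros t _. apply sqrt_le_1_alt. cbn [met cigar plane].
        rewrite g_prod_split. fold (e t) (e' t).
        assert (0 <= vertical (c t) (c' t) * vertical (c t) (c' t) / cosh_sq (sq (fst (c t)))).
        { apply Rdiv_le_0_compat; [apply Rle_0_sqr|]. pose proof (cosh_sq_ge1 _ (sq_ge0 (fst (c t)))). lra. }
        lra.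
Qed.

(** The horizontal lift of a curve [c] is [(rot (s t) (c t), s t)], where [s'] is the last coordinate
    of [horizontal_lift].  Rotational symmetry makes it depend on [c] and [c'] only, so that
    [s] is a plain integral instead of the solution of a differential equation. *)
Lemma lift_path p y1 y2 L : (0 < p)%nat -> pw_path cigar y1 y2 L ->
  forall x, unwind x = y1 ->
  exists x', unwind x' = y2 /\ pw_path (Zp_space p) (cov_Zp p x) (cov_Zp p x') L.
Proof.
  intros Hp H. induction H as [y|c c' y L H1 H2 _ IH]; intros x Hx.
  - exists x. split; [exact Hx|apply (pw_nil (Zp_space p))].
  - cbn [cov cigar plane] in *. cbn [model cigar plane] in c, c'.
    set (s' := fun t => - (sinhc (sq (c t)) ^ 2 * cross (c t) (c' t) / cosh_sq (sq (c t)))).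
    assert (Hcc : forall t, continuous c t) by (intros t; apply (is_derive_cont R2 c t _ (H1 t))).
    assert (Hs' : forall t, continuous s' t).
    { intros t. unfold s', cross. unfold Rdiv.
      pose proof (cont_fst RN RN c t (Hcc t)). pose proof (cont_snd RN RN c t (Hcc t)).
      pose proof (cont_fst RN RN c' t (H2 t)). pose proof (cont_snd RN RN c' t (H2 t)).
      assert (continuous (fun t => sinhc (sq (c t)) ^ 2) t).
      { apply (continuous_comp c (fun z => sinhc (sq z) ^ 2)); [apply Hcc|].
        apply (smooth_sinhc_sq R2 sq smooth_sq_R2 0%nat). }
      assert (continuous (fun t => / cosh_sq (sq (c t))) t).
      { apply (continuous_comp c (fun z => / cosh_sq (sq z))); [apply Hcc|].
        apply (smooth_inv_cosh_sq R2 sq smooth_sq_R2 sq_ge0 0%nat). }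
      cont. }
    set (s := fun t => snd x + RInt s' 0 t).
    assert (Hs : forall t, is_derive s t (s' t)).
    { intros t. unfold s. rewrite <- (Rplus_0_l (s' t)).
      apply (is_derive_plus (V := R_NormedModule) (fun _ => snd x) (fun t => RInt s' 0 t));
        [exact (is_derive_const (V := R_NormedModule) (snd x) t)|].
      apply (is_derive_RInt (V := R_NormedModule) s' _ 0); [|apply Hs'].
      apply filter_forall. intros b. apply (RInt_correct (V := R_CompleteNormedModule)).
      apply (ex_RInt_continuous (V := R_CompleteNormedModule)). intros u _. apply Hs'. }
    set (e := fun t => (rot (s t) (c t), s t) : model_PxS1).
    set (e' := fun t => horizontal_lift (e t) (c' t)).
    assert (Hs'e : forall t, snd (e' t) = s' t).
    { intros t. unfold e', horizontal_lift, e, s'. cbn [fst snd]. now rewrite sq_rot, cross_rot. }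
    assert (Hes : forall t, continuous s t) by (intros t; apply (is_derive_cont RN s t _ (Hs t))).
    assert (He' : forall t, e' t = ((fst (rot (s t) (c' t)) - s' t * snd (rot (s t) (c t)),
       snd (rot (s t) (c' t)) + s' t * fst (rot (s t) (c t))), s' t)).
    { intros t. rewrite <- Hs'e. reflexivity. }
    assert (He1 : forall t, is_derive e t (e' t)).
    { intros t. rewrite He'.
      pose proof (is_derive_fst RN RN c t _ (H1 t)) as Hd1.
      pose proof (is_derive_snd RN RN c t _ (H1 t)) as Hd2.
      assert (Hcos : is_derive (fun t => cos (s t)) t (s' t * - sin (s t))).
      { apply (is_derive_comp cos s); [apply is_derive_cos|apply Hs]. }
      assert (Hsin : is_derive (fun t => sin (s t)) t (s' t * cos (s t))).
      { apply (is_derive_comp sin s); [apply is_derive_sin|apply Hs]. }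
      apply (is_derive_pair R2 RN); [|apply Hs]. unfold rot. apply (is_derive_pair RN RN).
      - evar_last.
        + apply (is_derive_minus (fun t => cos (s t) * fst (c t)) (fun t => sin (s t) * snd (c t)));
            apply Derive.is_derive_mult; eassumption.
        + unfold minus, plus, opp; simpl. ring.
      - evar_last.
        + apply (is_derive_plus (fun t => sin (s t) * fst (c t)) (fun t => cos (s t) * snd (c t)));
            apply Derive.is_derive_mult; eassumption.
        + unfold minus, plus, opp; simpl. ring. }
    assert (He2 : forall t, continuous e' t).
    { intros t. apply (continuous_ext _ e' t (fun u => eq_sym (He' u))).
      pose proof (continuous_rot s c t (Hes t) (Hcc t)) as Hr.
      pose proof (continuous_rot s c' t (Hes t) (H2 t)) as Hr'.
      pose proof (cont_fst RN RN _ t Hr). pose proof (cont_snd RN RN _ t Hr).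
      pose proof (cont_fst RN RN _ t Hr'). pose proof (cont_snd RN RN _ t Hr').
      specialize (Hs' t).
      apply (continuous_pair _ R2 RN); [apply (continuous_pair _ RN RN)|]; cont. }
    assert (Hue : forall t, unwind (e t) = c t).
    { intros t. unfold unwind, e. cbn [fst snd]. rewrite rot_rot.
      replace (- s t + s t) with 0 by ring. apply rot_0. }
    assert (He0 : e 0 = x).
    { rewrite (unwind_eq x (e 0)); [|now rewrite Hue].
      assert (Hz : s 0 = snd x).
      { unfold s. rewrite RInt_point. apply Rplus_0_r. }
      change (screw (s 0 - snd x) x = x). rewrite Hz, (Rminus_diag (snd x)). apply screw_0. }
    destruct (IH (e 1) (Hue 1)) as [x' [Hx'1 Hx'2]]. exists x'. split; [exact Hx'1|].
    rewrite <- He0.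
    replace (RInt (fun t => sqrt (met cigar (c t) (c' t) (c' t))) 0 1) with (RInt (speed (Zp_space p) e e') 0 1).
    + apply (@pw_cons (Zp_space p) e e'); assumption.
    + apply RInt_ext. intros t _. unfold speed. f_equal. cbn [met Zp_space Zp_quotient cigar plane].
      rewrite g_prod_split, Hue. unfold e'. rewrite dunwind_horizontal_lift, vertical_horizontal_lift. unfold Rdiv. ring.
Qed.

(** A piece of an S^1-orbit: its generator has the constant norm [cosh rho]. *)
Lemma fibre_path p x (d : R) :
  pw_path (Zp_space p) (cov_Zp p x) (cov_Zp p (screw d x)) (Rabs d * sqrt (cosh_sq (sq (fst x)))).
Proof.
  set (c := fun t : R => screw (t * d) x).
  set (c' := fun t : R => (rot (t * d) (- (d * snd (fst x)), d * fst (fst x)), d) : model_PxS1).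
  assert (H1 : forall t, is_derive c t (c' t)).
  { intros t. unfold c, c', screw, rot. clear c c'.
    destruct x as [[x1 x2] u]. cbn [fst snd].
    apply (is_derive_pair R2 RN); [apply (is_derive_pair RN RN)|].
    - auto_derive; [easy|]. ring.
    - auto_derive; [easy|]. ring.
    - auto_derive; [easy|]. ring. }
  assert (H2 : forall t, continuous c' t).
  { intros t. assert (continuous (fun t : R => t) t) by apply continuous_id.
    unfold c'. apply (continuous_pair _ R2 RN); [|cont]. apply continuous_rot; [|apply continuous_const]. cont. }
  pose proof (pw_path_1 (Zp_space p) c c' H1 H2) as H.
  cbn [cov Zp_space Zp_quotient] in H.
  replace (c 0) with x in H by (unfold c; rewrite Rmult_0_l; symmetry; apply screw_0).
  replace (c 1) with (screw d x) in H by (unfold c; now rewrite Rmult_1_l).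
  replace (RInt (speed (Zp_space p) c c') 0 1) with (Rabs d * sqrt (cosh_sq (sq (fst x)))) in H; [exact H|].
  rewrite (RInt_ext _ (fun _ => Rabs d * sqrt (cosh_sq (sq (fst x))))).
  - rewrite RInt_const. change scal with Rmult. ring.
  - intros t _. unfold speed. cbn [met Zp_space Zp_quotient].
    rewrite <- sqrt_Rsqr_abs, <- sqrt_mult_alt by apply Rle_0_sqr. f_equal.
    change (c' t) with (rot (t * d) (fst ((- (d * snd (fst x)), d * fst (fst x)), d)), snd ((- (d * snd (fst x)), d * fst (fst x)), d)).
    unfold c. rewrite g_prod_screw. unfold g_prod, radial, cosh_sq. cbn [fst snd].
    rewrite <- K_hyp_eq. unfold dot, cross, sq, Rsqr. cbn [fst snd]. ring.
Qed.

Definition dist_Zp p := riem_dist (Zp_space p).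
Definition dist_cigar := riem_dist cigar.

Lemma dist_project p a b : (0 < p)%nat -> dist_cigar (to_cigar p a) (to_cigar p b) <= dist_Zp p a b.
Proof.
  intros Hp. apply riem_dist_glb; [apply continuous_met_Zp|apply surjective_cov_Zp|].
  intros L HL. destruct (project_path p a b L Hp HL) as [L' [H1 H2]].
  apply Rle_trans with L'; [|exact H2].
  apply riem_dist_glb; [apply continuous_met_cigar|apply surjective_cov_cigar|exact H1].
Qed.

Lemma zp_angle_close p (t : R) : (0 < p)%nat -> exists k, Rabs (zp_angle p k - t) <= 2 * PI / INR p.
Proof.
  intros Hp. assert (HP : 0 < INR p) by (apply lt_0_INR; lia). pose proof PI_RGT_0.
  assert (Hc : 0 < 2 * PI / INR p) by (apply Rdiv_lt_0_compat; lra). set (c := 2 * PI / INR p) in *.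
  destruct (archimed (t / c)) as [H1 H2]. exists (up (t / c)).
  replace (zp_angle p (up (t / c)) - t) with (c * (IZR (up (t / c)) - t / c))
    by (unfold zp_angle, c; field; lra).
  rewrite Rabs_mult, (Rabs_pos_eq c), (Rabs_pos_eq (_ - _)) by lra. nra.
Qed.

(** Lift horizontally a curve between the images: it ends on the S^1-orbit of [b], at an angle within
    [2 pi / p] of a multiple of [2 pi / p], and is completed along this orbit. *)
Lemma dist_lift p a b : (0 < p)%nat ->
  dist_Zp p a b <= dist_cigar (to_cigar p a) (to_cigar p b) + 2 * PI / INR p * sqrt (cosh_sq (sq (to_cigar p b))).
Proof.
  intros Hp. destruct (cov_Zp_surj p a) as [xa ->], (cov_Zp_surj p b) as [xb ->].
  rewrite !to_cigar_cov by exact Hp.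
  set (B := 2 * PI / INR p * _). enough (dist_Zp p (cov_Zp p xa) (cov_Zp p xb) - B <= dist_cigar (unwind xa) (unwind xb)) by lra.
  apply riem_dist_glb; [apply continuous_met_cigar|apply surjective_cov_cigar|].
  intros L HL. destruct (lift_path p _ _ L Hp HL xa eq_refl) as [x' [H1 H2]].
  destruct (zp_angle_close p (snd x' - snd xb) Hp) as [k Hk].
  set (d := zp_angle p k - (snd x' - snd xb)) in *.
  assert (Hx' : x' = screw (snd x' - snd xb) xb) by (apply unwind_eq; now symmetry).
  pose proof (fibre_path p x' d) as H3.
  replace (cov_Zp p (screw d x')) with (cov_Zp p xb) in H3.
  2:{ apply cov_Zp_eq; [exact Hp|]. exists k. rewrite Hx' at 1. rewrite screw_screw. f_equal. unfold d. ring. }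
  pose proof (pw_path_app (Zp_space p) _ _ _ _ _ H2 H3) as H4.
  assert (Hd : dist_Zp p (cov_Zp p xa) (cov_Zp p xb) <= L + Rabs d * sqrt (cosh_sq (sq (fst x')))).
  { apply riem_dist_glb; [apply continuous_met_Zp|apply surjective_cov_Zp|exact H4]. }
  assert (HB : Rabs d * sqrt (cosh_sq (sq (fst x'))) <= B).
  { unfold B. rewrite <- H1. unfold unwind. rewrite sq_rot.
    apply Rmult_le_compat_r; [apply sqrt_pos|exact Hk]. }
  lra.
Qed.

(** The differential of [ln (1 + rho^2)] is [2 rho / (1 + rho^2) drho], with coefficient at most 1.
    Unlike [rho] this function is smooth at the origin. *)
Lemma log_growth y1 y2 L : pw_path cigar y1 y2 L -> ln (1 + sq y2) <= ln (1 + sq y1) + L.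
Proof.
  intros H. induction H as [y|c c' y L H1 H2 _ IH]; [lra|].
  cbn [cov cigar plane] in *. cbn [model cigar plane] in c, c'.
  set (l' := fun t => 2 * dot (c t) (c' t) * / (1 + sq (c t))).
  assert (Hp : forall t, 0 < 1 + sq (c t)) by (intros t; pose proof (sq_ge0 (c t)); lra).
  assert (Hcc : forall t, continuous c t) by (intros t; apply (is_derive_cont R2 c t _ (H1 t))).
  assert (Hl : forall t, is_derive (fun t => ln (1 + sq (c t))) t (l' t)).
  { intros t. apply (is_derive_comp ln (fun t => 1 + sq (c t))); [now apply is_derive_ln|].
    pose proof (is_derive_fst RN RN c t _ (H1 t)) as Hd1.
    pose proof (is_derive_snd RN RN c t _ (H1 t)) as Hd2.
    unfold sq. evar_last.
    - apply (is_derive_plus (fun _ => 1)); [apply is_derive_const|].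
      apply (is_derive_plus (fun t => fst (c t) ^ 2) (fun t => snd (c t) ^ 2)); apply is_derive_pow; eassumption.
    - unfold plus, dot; simpl. change zero with 0. ring. }
  assert (Hl' : forall t, continuous l' t).
  { intros t. pose proof (cont_fst RN RN c t (Hcc t)). pose proof (cont_snd RN RN c t (Hcc t)).
    pose proof (cont_fst RN RN c' t (H2 t)). pose proof (cont_snd RN RN c' t (H2 t)).
    assert (continuous (fun t => / (1 + sq (c t))) t).
    { apply (continuous_comp c (fun z => / (1 + sq z))); [apply Hcc|].
      enough (Hi : smooth R2 RN (fun z => / (1 + sq z))) by apply (Hi 0%nat).
      apply (smooth_Rinv R2 (fun z => 1 + sq z)).
      - apply smooth_Rplus; [apply (smooth_const R2 RN)|exact smooth_sq_R2].
      - intros z. pose proof (sq_ge0 z). lra. }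
    unfold l', dot. cont. }
  assert (HI : RInt l' 0 1 = ln (1 + sq (c 1)) - ln (1 + sq (c 0))).
  { apply (is_RInt_unique (V := R_CompleteNormedModule)).
    apply (is_RInt_derive (V := R_CompleteNormedModule) (fun t => ln (1 + sq (c t)))); intros; auto. }
  enough (RInt l' 0 1 <= RInt (speed cigar c c') 0 1) by (unfold speed in *; lra).
  apply RInt_le; [lra| | |].
  - apply (ex_RInt_continuous (V := R_CompleteNormedModule)). intros; apply Hl'.
  - apply speed_integrable; [exact continuous_met_cigar|exact H1|exact H2].
  - intros t _. unfold speed. cbn [met cigar plane]. apply Rsqr_incr_0_var; [|apply sqrt_pos].
    rewrite Rsqr_sqrt by apply radial_cig_ge0. unfold l', Rsqr.
    pose proof (radial_ge K_cig (c t) (c' t) (Rlt_le _ _ (K_cig_pos (c t)))) as Hr.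
    pose proof (radial_cig_ge0 (c t) (c' t)) as H0. specialize (Hp t). pose proof (sq_ge0 (c t)) as Hu.
    set (q := radial K_cig _ _ _) in *. set (u := sq (c t)) in *. set (b := dot _ _) in *.
    apply (Rmult_le_reg_r ((1 + u) ^ 2)); [now apply pow_lt|].
    replace (2 * b * / (1 + u) * (2 * b * / (1 + u)) * (1 + u) ^ 2) with (4 * b ^ 2) by (field; lra).
    pose proof (pow2_ge_0 (1 - u)). nra.
Qed.

Lemma sq_bound y1 y2 r : dist_cigar y1 y2 < r -> 1 + sq y2 <= (1 + sq y1) * exp r.
Proof.
  intros H. pose proof (sq_ge0 y1). pose proof (sq_ge0 y2).
  assert (Hl : ln (1 + sq y2) - ln (1 + sq y1) <= dist_cigar y1 y2).
  { apply riem_dist_glb; [apply continuous_met_cigar|apply surjective_cov_cigar|].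
    intros L HL. pose proof (log_growth _ _ _ HL). lra. }
  rewrite <- (exp_ln (1 + sq y2)), <- (exp_ln (1 + sq y1)) at 1 by lra. rewrite <- exp_plus.
  left. apply exp_increasing. lra.
Qed.

Lemma cosh_sq_bound z : sqrt (cosh_sq (sq z)) <= exp (1 + sq z).
Proof.
  rewrite <- (rho_sq z) at 1. rewrite <- cosh_sq_cosh.
  assert (Hr : 0 <= rho z) by apply sqrt_pos.
  assert (Hc : 0 < cosh (rho z)) by (unfold cosh; pose proof (exp_pos (rho z)); pose proof (exp_pos (- rho z)); lra).
  rewrite sqrt_pow2 by lra.
  apply Rle_trans with (exp (rho z)).
  - unfold cosh. assert (exp (- rho z) <= exp (rho z)); [|lra].
    destruct Hr as [Hr|<-]; [left; apply exp_increasing; lra|rewrite Ropp_0; lra].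
  - left. apply exp_increasing. rewrite <- rho_sq. nra.
Qed.

(** The radius of the ball bounds [cosh rho] by a constant [B] that does not depend on [p]; the
    distortion of [to_cigar] is then at most [2 pi B / p]. *)
Lemma pGH_Zp (p : nat -> nat) (m0 : R2 * S1) (z0 : R2) :
  (forall i, (0 < p i)%nat) -> filterlim p eventually eventually ->
  ident z0 = cls orb_S1 m0 ->
  pGH_cv (fun i => quot (orb_Zp (p i))) (fun i => dist_Zp (p i)) (fun i => cls (orb_Zp (p i)) m0) dist_cigar z0.
Proof.
  intros Hp Hlim Hz r eps Hr Heps.
  apply ident_eq in Hz.
  set (B := exp ((1 + sq z0) * exp r)).
  assert (HB : 0 < B) by apply exp_pos.
  assert (Hball : forall y, dist_cigar z0 y < r -> sqrt (cosh_sq (sq y)) <= B).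
  { intros y Hy. eapply Rle_trans; [apply cosh_sq_bound|]. pose proof (sq_bound _ _ _ Hy) as [H|H].
    - left. now apply exp_increasing.
    - right. unfold B. now rewrite H. }
  pose proof PI_RGT_0 as HPI.
  destruct (archimed_cor1 (eps / (2 * PI * B))) as [N [HN1 HN2]].
  { apply Rdiv_lt_0_compat; [lra|nra]. }
  destruct (Hlim (fun n => (N <= n)%nat)) as [n0 Hn0]; [now exists N|].
  exists n0. intros n Hn. specialize (Hn0 n Hn). specialize (Hp n).
  set (q := p n) in *. clearbody q.
  assert (Hq : 2 * PI / INR q * B < eps).
  { assert (HNp : 0 < INR N) by (apply lt_0_INR; lia).
    assert (Hle : INR N <= INR q) by now apply le_INR.
    assert (Hinv : / INR q <= / INR N) by now apply Rinv_le_contravar.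
    assert (H2 : 0 < 2 * PI * B) by nra.
    replace eps with (2 * PI * B * (eps / (2 * PI * B))) by (field; nra).
    unfold Rdiv at 1. replace (2 * PI * / INR q * B) with (2 * PI * B * / INR q) by ring.
    apply Rmult_lt_compat_l; lra. }
  assert (HqP : 0 <= 2 * PI / INR q).
  { apply Rdiv_le_0_compat; [lra|]. apply lt_0_INR. lia. }
  assert (Hbase : to_cigar q (cls (orb_Zp q) m0) = z0).
  { rewrite Hz. destruct m0 as [z sg]. destruct (angle_surj sg) as [s ->].
    rewrite unwind_pt_angle. apply (to_cigar_cov q (z, s) Hp). }
  assert (Hup : forall a b, dist_cigar z0 (to_cigar q b) < r ->
      dist_Zp q a b < dist_cigar (to_cigar q a) (to_cigar q b) + eps).
  { intros a b Hb. eapply Rle_lt_trans; [apply (dist_lift q a b Hp)|].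
    apply Rplus_lt_compat_l. eapply Rle_lt_trans; [|exact Hq].
    apply Rmult_le_compat_l; [exact HqP|now apply Hball]. }
  exists (to_cigar q). split; [exact Hbase|]. split.
  - intros a b _ Hb.
    assert (Hb' : dist_cigar z0 (to_cigar q b) < r).
    { rewrite <- Hbase. eapply Rle_lt_trans; [apply (dist_project q _ b Hp)|exact Hb]. }
    pose proof (Hup a b Hb'). pose proof (dist_project q a b Hp).
    rewrite Rabs_left1 by lra. lra.
  - intros b Hb. destruct (unwind_surj b) as [x Hx]. exists (cov_Zp q x).
    assert (Hf : to_cigar q (cov_Zp q x) = b) by (now rewrite to_cigar_cov).
    split.
    + assert (Hb' : dist_cigar z0 (to_cigar q (cov_Zp q x)) < r) by (rewrite Hf; lra).
      pose proof (Hup (cls (orb_Zp q) m0) (cov_Zp q x) Hb') as H. rewrite Hbase, Hf in H. lra.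
    + rewrite Hf. unfold dist_cigar. rewrite riem_dist_self; [exact Heps|exact continuous_met_cigar|exact surjective_cov_cigar].
Qed.

Theorem mainTheorem1 :
  (* (rho, theta) |-> [rho, theta, 0] identifies P with the S^1-quotient *)
  (forall q : quot orb_S1, exists! z : R2, ident z = q) /\
  (* the quotient metric is d rho^2 + tanh^2 rho d theta^2 *)
  (forall h : tensor R2,
     is_Upsilon g_hyp h <-> (forall z v w, h z v w = rot_metric tanh z v w)) /\
  (* which is Hamilton's cigar *)
  riem_isometry g_cigar (rot_metric tanh) cigar_polar /\
  (* the quotients by Z_p carry a quotient metric *)
  (forall p : nat, (0 < p)%nat -> exists h, is_Zp_quotient_metric p g_hyp h) /\
  (* and converge to the cigar *)
  (forall (p : nat -> nat) (h : nat -> tensor model_PxS1) (m0 : R2 * S1) (z0 : R2),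
     (forall i, (0 < p i)%nat) ->
     filterlim p eventually eventually ->
     (forall i, is_Zp_quotient_metric (p i) g_hyp (h i)) ->
     ident z0 = cls orb_S1 m0 ->
     pGH_cv (fun i => quot (orb_Zp (p i)))
       (fun i => riem_dist (Zp_quotient (p i) (h i)))
       (fun i => cls (orb_Zp (p i)) m0)
       (riem_dist (plane (rot_metric tanh))) z0).
Proof.
  assert (Hcig : rot_metric tanh = radial K_cig).
  { do 3 (apply functional_extensionality; intros ?). apply rot_tanh_radial. }
  split; [exact ident_bij|]. split; [|split; [exact cigar_isometry|split]].
  - intros h. rewrite Hcig. split; [apply is_Upsilon_unique|].
    intros H. replace h with (radial K_cig); [exact is_Upsilon_cigar|].
    do 3 (apply functional_extensionality; intros ?). symmetry. apply H.
  - intros p Hp. exists g_prod. now apply is_Zp_quotient_metric_g_prod.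
  - intros p h m0 z0 Hp Hlim Hh Hz. rewrite Hcig.
    replace h with (fun _ : nat => g_prod); [now apply pGH_Zp|].
    apply functional_extensionality; intros i.
    do 3 (apply functional_extensionality; intros ?). symmetry.
    now apply (is_Zp_quotient_metric_unique (p i)).
Qed.
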